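(* There exist a bounded potential $V:\mathbb{Z}\to\mathbb{R}$ and a compact interval $K\subseteq\mathbb{R}$ such that $\dim_{\mathrm H}(K\cap\operatorname{spec}H^{[\ell]})>0$ for every $\ell\in\mathbb{N}$, but $$\lim_{\ell\to\infty}\dim_{\mathrm H}(K\cap\operatorname{spec}H^{[\ell]})=0,$$ where $H^{[\ell]}=\Delta+V^{[\ell]}$ is the discrete Schr\''odinger operator on $\ell^2(\mathbb{Z})$ whose potential is the $\ell$-fold sieve $V^{[\ell]}$ of $V$.
   Context: For a bounded $W:\mathbb{Z}\to\mathbb{R}$, the discrete Schr\''odinger operator $\Delta+W$ acts in $\ell^2(\mathbb{Z})$ by $[(\Delta+W)\psi](n)=\psi(n-1)+\psi(n+1)+W(n)\psi(n)$. For $\ell\in\mathbb{N}=\{1,2,3,\ldots\}$, the $\ell$-fold sieve of $V$ is the potential $V^{[\ell]}:\mathbb{Z}\to\mathbb{R}$ with $V^{[\ell]}(n)=V(n/\ell)$ if $n\in\ell\mathbb{Z}$ and $V^{[\ell]}(n)=0$ if $n\notin\ell\mathbb{Z}$. Here $\operatorname{spec}$ denotes the spectrum and $\dim_{\mathrm H}$ the Hausdorff dimension. *)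

(* Defs.v *)
From HB Require Import structures.
From mathcomp Require Import all_boot all_order all_algebra.
From mathcomp Require Import complex.
From mathcomp Require Import all_classical all_reals all_analysis.

Set Implicit Arguments.
Unset Strict Implicit.
Unset Printing Implicit Defensive.

Import Order.TTheory GRing.Theory Num.Theory.
Import numFieldNormedType.Exports.

Local Open Scope classical_set_scope.
Local Open Scope ring_scope.

Section HausdorffDimension.
Context {R : realType}.
Implicit Types (U A : set R) (s delta : R).
Local Open Scope ereal_scope.

Definition diam U : \bar R :=
  ereal_sup [set `|x - y|%:E | x in U & y in U].

(* [poweR 0 0 = 1], so points have 0-dimensional weight 1; the empty set,
   whose [diam] is -oo, must have weight 0 for every s. *)
Definition diam_pow s U : \bar R :=
  if `[< U = set0 >] then 0 else poweR (diam U) s.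

Definition hausdorff_premeasure s delta A : \bar R :=
  ereal_inf [set \sum_(0 <= i <oo) diam_pow s (U i) |
    U in [set U : (set R)^nat |
      A `<=` \bigcup_i U i /\ forall i, diam (U i) <= delta%:E]].

Definition hausdorff_measure s A : \bar R :=
  ereal_sup [set hausdorff_premeasure s delta A |
    delta in [set delta : R | (0 < delta)%R]].

Definition hausdorff_dim A : \bar R :=
  ereal_inf [set s%:E |
    s in [set s : R | (0 <= s)%R /\ hausdorff_measure s A = 0]].

End HausdorffDimension.

(* l^2(Z) is the set of those psi : int -> R[i] with finite [l2norm];
   operators in l^2(Z) are represented by maps on all sequences, of which only
   the restriction to [ell2] matters. *)
Section SpectrumInEll2.
Context {R : realType}.
Local Notation C := R[i].
Implicit Types (psi phi : int -> C) (A T : (int -> C) -> (int -> C)).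

Definition l2norm psi : \bar R :=
  sqrte (\esum_(n in [set: int]) ((ComplexField.Normc.normc (psi n)) ^+ 2)%:E).

Definition ell2 : set (int -> C) := [set psi | (l2norm psi < +oo)%E].

(* The norm bound with finite constant M makes T map [ell2] into itself. *)
Definition bounded_operator T : Prop :=
  (forall (a : C) psi phi, ell2 psi -> ell2 phi ->
     T (fun n => a * psi n + phi n) = (fun n => a * T psi n + T phi n)) /\
  (exists M : R, forall psi, ell2 psi -> (l2norm (T psi) <= M%:E * l2norm psi)%E).

Definition sub_scalar A (z : C) : (int -> C) -> (int -> C) :=
  fun psi n => A psi n - z * psi n.

Definition resolvent_set A : set C :=
  [set z | exists T, bounded_operator T /\
     forall psi, ell2 psi ->
       T (sub_scalar A z psi) = psi /\ sub_scalar A z (T psi) = psi].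

Definition spectrum A : set C := ~` resolvent_set A.

End SpectrumInEll2.

Section Schroedinger.
Context {R : realType}.

Definition schroedinger (W : int -> R) (psi : int -> R[i]) : int -> R[i] :=
  fun n => psi (n - 1) + psi (n + 1) + (W n)%:C%C * psi n.

Definition sieve (l : nat) (V : int -> R) : int -> R :=
  fun n => if (l%:Z %| n)%Z then V (n %/ l%:Z)%Z else 0.

Definition real_spectrum (A : (int -> R[i]) -> (int -> R[i])) : set R :=
  [set x | spectrum A x%:C%C].

End Schroedinger.

(* Main.v *)
(** The potential has a well of height 4 at each position 4 ^ j, followed by the
    binary digits of j as values in {0, -1}; it vanishes on the left half line.
    For E in [4, 5] only a well can resonate: if q and q' are the values seen on
    its two sides, elimination of these sites (a continued fraction [cf]) leaves
    the secular equation E - 4 = cf E q + cf E q'.  In the l-fold sieve the k-th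
    digit sits at distance l k and shifts the root by an amount between 36 ^ - (l k)
    and 9 ^ - (l k), up to constants.  Every sequence of digits occurs, up to any
    length, next to some well, so all these roots lie in the spectrum, and the map
    from a root back to the number in [0, 1) with the given binary digits is
    Hoelder of exponent 1 / (6 l); hence the dimension is at least 1 / (6 l).
    Conversely a point of [4, 5] in the spectrum is either a limit of roots for
    pairs of digit sequences (one on each side), and these are covered by 4 ^ n
    sets of diameter O(9 ^ - (l n)), or an eigenvalue, and there are countably many of these; hence the dimension is at
    most 1 / l. *)
Require Import Defs.
From mathcomp Require Import all_boot all_order all_algebra.
From mathcomp Require Import complex zify ring lra.
From mathcomp Require Import all_classical all_reals all_analysis.

Import Order.TTheory GRing.Theory Num.Theory.
Import numFieldNormedType.Exports.

Local Open Scope classical_set_scope.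
Local Open Scope ring_scope.

(** * Continued fractions *)

Section ContinuedFraction.
Context {R : realType}.
Implicit Types (E x : R) (q : nat -> R) (n N : nat).

Definition wellpot q := forall i, -1 <= q i <= 0.

Definition qshift n q : nat -> R := fun i => q (n + i)%N.

Fixpoint cfn E q N : R :=
  if N is N'.+1 then (E - q 0%N - cfn E (qshift 1 q) N')^-1 else 0.

Definition cf E q : R := limn (cfn E q).

Lemma wellpot_qshift n q : wellpot q -> wellpot (qshift n q).
Proof. by move=> h i; apply: h. Qed.

Lemma cfn_bounds E q N : 4 <= E -> wellpot q -> 0 <= cfn E q N <= 3^-1.
Proof.
move=> E4; elim: N q => [|N IH] q qw /=; first by lra.
have /IH := wellpot_qshift 1 _ qw; have := qw 0%N.
set m := cfn _ _ _; move=> h0 hm.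
have : 3 <= E - q 0%N - m by lra.
by move=> h; rewrite invr_ge0 lef_pV2 ?posrE; lra.
Qed.

Lemma cfn_homo E q : 4 <= E -> wellpot q ->
  nondecreasing_seq (cfn E q).
Proof.
move=> E4 qw; apply/nondecreasing_seqP => N.
elim: N q qw => [|N IH] q qw.
  by have /andP[] := cfn_bounds E q 1 E4 qw.
have qw1 := wellpot_qshift 1 _ qw.
have := IH _ qw1; have := qw 0%N.
have := cfn_bounds E _ N E4 qw1; have := cfn_bounds E _ N.+1 E4 qw1.
move=> h1 h2 h3 h4.
have h5 : 3 <= E - q 0%N - cfn E (qshift 1 q) N.+1 by lra.
have h6 : 3 <= E - q 0%N - cfn E (qshift 1 q) N by lra.
suff : (E - q 0 - cfn E (qshift 1 q) N)^-1 <=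
       (E - q 0 - cfn E (qshift 1 q) N.+1)^-1 by [].
rewrite lef_pV2 ?posrE; lra.
Qed.

Lemma cfn_cvg E q : 4 <= E -> wellpot q -> cfn E q @ \oo --> cf E q.
Proof.
move=> E4 qw; apply: nondecreasing_is_cvgn; first exact: cfn_homo.
by exists (3^-1) => _ [n _ <-]; have /andP[] := cfn_bounds E q n E4 qw.
Qed.

Lemma cf_bounds E q : 4 <= E -> wellpot q -> 0 <= cf E q <= 3^-1.
Proof.
move=> E4 qw; have cv := cfn_cvg E q E4 qw.
apply/andP; split.
  apply: limr_ge; first exact: cv.
  by near=> n; have /andP[] := cfn_bounds E q n E4 qw.
apply: limr_le; first exact: cv.
by near=> n; have /andP[] := cfn_bounds E q n E4 qw.
Unshelve. all: by end_near. Qed.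

Lemma cfE E q : 4 <= E -> wellpot q ->
  cf E q = (E - q 0%N - cf E (qshift 1 q))^-1.
Proof.
move=> E4 qw; have qw1 := wellpot_qshift 1 _ qw.
have h := qw 0%N; have hm := cf_bounds E _ E4 qw1.
have cv : cfn E q @ \oo --> (E - q 0%N - cf E (qshift 1 q))^-1.
  rewrite -(cvg_shiftS (cfn E q)) /=; apply: cvgV; first by rewrite gt_eqF//; lra.
  by apply: cvgB; [exact: cvg_cst | exact: cfn_cvg].
by rewrite {1}/cf; exact: cvg_lim cv.
Qed.

Lemma cf_eq E q : 4 <= E -> wellpot q ->
  cf E q * (E - q 0%N - cf E (qshift 1 q)) = 1.
Proof.
move=> E4 qw; rewrite cfE// mulVf// gt_eqF//.
have h := qw 0%N; have hm := cf_bounds E _ E4 (wellpot_qshift 1 _ qw).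
lra.
Qed.

Lemma cf_ge E q : 4 <= E <= 5 -> wellpot q -> 6^-1 <= cf E q.
Proof.
move=> /andP[E4 E5] qw; rewrite cfE//.
have h := qw 0%N; have hm := cf_bounds E _ E4 (wellpot_qshift 1 _ qw).
rewrite lef_pV2 ?posrE; lra.
Qed.

Lemma cfB E E' q q' : 4 <= E -> 4 <= E' -> wellpot q -> wellpot q' ->
  cf E q - cf E' q' = cf E q * cf E' q' *
    ((E' - E) + (q 0%N - q' 0%N) + (cf E (qshift 1 q) - cf E' (qshift 1 q'))).
Proof.
move=> E4 E4' qw qw'.
have h1 := cf_eq E q E4 qw; have h2 := cf_eq E' q' E4' qw'.
transitivity (cf E q * (cf E' q' * (E' - q' 0%N - cf E' (qshift 1 q'))) -
   cf E' q' * (cf E q * (E - q 0%N - cf E (qshift 1 q)))).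
  by rewrite h1 h2 !mulr1.
ring.
Qed.

Lemma cfM_bounds E E' q q' : 4 <= E <= 5 -> 4 <= E' <= 5 ->
  wellpot q -> wellpot q' -> 36^-1 <= cf E q * cf E' q' <= 9^-1.
Proof.
move=> hE hE' qw qw'.
have := cf_ge E q hE qw; have := cf_ge E' q' hE' qw'.
case/andP: hE => E4 _; case/andP: hE' => E4' _.
have := cf_bounds E q E4 qw; have := cf_bounds E' q' E4' qw'.
move: (cf _ _) (cf _ _) => a b h1 h2 h3 h4.
by apply/andP; split; nra.
Qed.

Lemma norm_cfB_le E E' q q' : 4 <= E <= 5 -> 4 <= E' <= 5 ->
  wellpot q -> wellpot q' ->
  `|cf E q - cf E' q'| <= 9^-1 *
    (`|E - E'| + `|q 0%N - q' 0%N| + `|cf E (qshift 1 q) - cf E' (qshift 1 q')|).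
Proof.
move=> hE hE' qw qw'; have := cfM_bounds E E' q q' hE hE' qw qw'.
case/andP: hE => E4 _; case/andP: hE' => E4' _.
move=> h; rewrite cfB// normrM ger0_norm; last by lra.
apply: ler_pM => //; first by lra.
  by case/andP: h.
by rewrite (le_trans (ler_normD _ _))// lerD2r (le_trans (ler_normD _ _))//
  lerD2r distrC.
Qed.

Lemma le_geometric_limit (r a b c : R) : 0 <= r < 1 ->
  (forall n, a <= b + c * r ^+ n) -> a <= b.
Proof.
move=> /andP[r0 r1] h.
have cv : (fun n : nat => b + geometric c r n) @ \oo --> b + 0.
  by apply: cvgD; [exact: cvg_cst | apply: cvg_geometric; rewrite ger0_norm].
rewrite -[b]addr0 -(cvg_lim _ cv)//.
by apply: limr_ge; [apply/cvg_ex; eexists; exact: cv | near=> n; exact: h].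
Unshelve. all: by end_near. Qed.

Lemma cf_lip E E' q : 4 <= E <= 5 -> 4 <= E' <= 5 -> wellpot q ->
  `|cf E q - cf E' q| <= 8^-1 * `|E - E'|.
Proof.
move=> hE hE' qw.
apply: (@le_geometric_limit 9^-1 _ _ 1); first by lra.
move=> n; rewrite mul1r; elim: n q qw => [|n IH] q qw.
  case/andP: hE => E4 _; case/andP: hE' => E4' _.
  have := cf_bounds E q E4 qw; have := cf_bounds E' q E4' qw.
  rewrite expr0; have := normr_ge0 (E - E').
  move: (cf _ _) (cf _ _) => a b h0 h1 h2.
  by rewrite ler_norml; apply/andP; split; lra.
have := norm_cfB_le E E' q q hE hE' qw qw.
have := IH _ (wellpot_qshift 1 _ qw).
rewrite subrr normr0 exprS; lra.
Qed.

Lemma cf_prefix E q q' n : 4 <= E <= 5 -> wellpot q -> wellpot q' ->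
  (forall i, (i < n)%N -> q i = q' i) ->
  `|cf E q - cf E q'| <= 9^-1 ^+ n.
Proof.
move=> hE; elim: n q q' => [|n IH] q q' qw qw' qq'.
  case/andP: hE => E4 _.
  have := cf_bounds E q E4 qw; have := cf_bounds E q' E4 qw'.
  rewrite expr0; move: (cf _ _) (cf _ _) => a b h1 h2.
  by rewrite ler_norml; apply/andP; split; lra.
have := norm_cfB_le E E q q' hE hE qw qw'.
rewrite qq'// !subrr normr0 !add0r exprS => /le_trans; apply.
rewrite ler_pM2l ?IH//; [exact: wellpot_qshift|exact: wellpot_qshift|].
by move=> i lin; apply: qq'.
Qed.

Lemma cf_separation E q q' n : 4 <= E <= 5 -> wellpot q -> wellpot q' ->
  (forall i, (i < n)%N -> q i = q' i) -> q n - q' n = 1 ->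
  36^-1 ^+ n / 54 <= `|cf E q - cf E q'|.
Proof.
move=> hE; elim: n q q' => [|n IH] q q' qw qw' qq' d.
  have hm := cfM_bounds E E q q' hE hE qw qw'.
  case/andP: (hE) => E4 _.
  rewrite cfB// subrr add0r d.
  have := cf_bounds E _ E4 (wellpot_qshift 1 _ qw).
  have := cf_bounds E _ E4 (wellpot_qshift 1 _ qw').
  move: hm; move: (cf E q * _) => a.
  move: (cf _ _) (cf _ _) => b c h1 h2 h3.
  rewrite ger0_norm; last by rewrite mulr_ge0//; lra.
  rewrite expr0 mul1r; apply: (@le_trans _ _ (36^-1 * (2 / 3))); first by lra.
  by apply: ler_pM; lra.
have hm := cfM_bounds E E q q' hE hE qw qw'.
case/andP: (hE) => E4 _.
rewrite cfB// subrr add0r qq'// subrr add0r normrM exprS -mulrA.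
apply: ler_pM; [lra| |by rewrite ger0_norm; lra|].
  by rewrite mulr_ge0// ?exprn_ge0//; lra.
apply: IH => //; [exact: wellpot_qshift|exact: wellpot_qshift|].
by move=> i lin; apply: qq'.
Qed.

(* Its zero in E is the eigenvalue of the well of height 4 at the origin between
   the half-line potentials q and q'. *)
Definition secular E q q' : R := E - 4 - cf E q - cf E q'.

Lemma secular_slope E E' q q' : 4 <= E <= 5 -> 4 <= E' <= 5 ->
  wellpot q -> wellpot q' ->
  3 / 4 * `|E - E'| <= `|secular E q q' - secular E' q q'| <= 5 / 4 * `|E - E'|.
Proof.
move=> hE hE' qw qw'; have := cf_lip E E' q hE hE' qw.
have := cf_lip E E' q' hE hE' qw'; rewrite /secular.
move: (cf E q) (cf E' q) (cf E q') (cf E' q') => a b c d.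
have -> : E - 4 - a - c - (E' - 4 - b - d) = (E - E') - (a - b) - (c - d) by ring.
move: (E - E') (a - b) (c - d) => x y z h1 h2.
have h3 := ler_normD (x - y - z) (y + z); have h4 := ler_normD y z.
have h5 := ler_normB (x - y) z; have h6 := ler_normB x y.
have e : x - y - z + (y + z) = x by ring.
by rewrite e in h3; apply/andP; split; lra.
Qed.

Lemma secular_root q q' : wellpot q -> wellpot q' ->
  exists2 E, 4 <= E <= 5 & secular E q q' = 0.
Proof.
move=> qw qw'.
pose g (x : R) := secular (Num.min 5 (Num.max 4 x)) q q'.
have clip (x : R) : 4 <= Num.min 5 (Num.max 4 x) <= 5.
  by rewrite le_min ge_min le_max !lexx /=; lra.
have max4 (x y : R) : `|Num.max 4 x - Num.max 4 y| <= `|x - y|.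
  have h1 := ler_norm (x - y); have h2 := ler_norm (y - x).
  rewrite distrC in h2; rewrite ler_norml.
  by case: (leP 4 x) => ?; case: (leP 4 y) => ?; lra.
have min5 (x y : R) : `|Num.min 5 x - Num.min 5 y| <= `|x - y|.
  have h1 := ler_norm (x - y); have h2 := ler_norm (y - x).
  rewrite distrC in h2; rewrite ler_norml.
  by case: (leP 5 x) => ?; case: (leP 5 y) => ?; lra.
have cg : {within `[4, 5], continuous g}.
  apply: continuous_subspaceT => x; rewrite /g.
  apply/(@cvgrPdist_le _ _ _ (nbhs x)) => e e0.
  near=> y.
  have := secular_slope _ _ q q' (clip x) (clip y) qw qw' => /andP[_].
  move=> /le_trans; apply.
  have h : `|Num.min 5 (Num.max 4 x) - Num.min 5 (Num.max 4 y)| <= `|x - y|.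
    apply: le_trans (min5 _ _) _; exact: max4.
  have : `|x - y| <= e / 2 by near: y; apply: cvgr_dist_le => //; lra.
  by move: h; lra.
have cE (x : R) : 4 <= x <= 5 -> Num.min 5 (Num.max 4 x) = x.
  by move=> /andP[? ?]; rewrite max_r// min_r.
have [|x /itvP hx gx] := @IVT _ g 4 5 0 ltac:(lra) cg.
  have b (x : R) : 4 <= x -> (0 <= cf x q <= 3^-1) /\ (0 <= cf x q' <= 3^-1).
    by move=> x4; split; exact: cf_bounds.
  have [b1 b2] := b 4 ltac:(lra); have [b3 b4] := b 5 ltac:(lra).
  rewrite /g /secular !cE; [|lra|lra].
  by rewrite ge_min le_max; apply/andP; split; apply/orP; [left|right]; lra.
by exists x; rewrite ?hx// -gx /g cE// !hx.
Unshelve. all: by end_near. Qed.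

End ContinuedFraction.

(** * Sums over windows and Jacobi operators *)

Section WindowSums.
Context {R : realType}.
Implicit Types (h f g : int -> R) (M : R) (x a n : int) (k K : nat).

Definition win h x k : R := \sum_(i < k) h (x + i%:Z).

(* For h >= 0: the sum of h over all integers is at most M. *)
Definition bnd h M := forall x k, win h x k <= M.

Lemma win_shift h a x k : win (fun n => h (n + a)) x k = win h (x + a) k.
Proof. by apply: eq_bigr => i _; rewrite addrAC. Qed.

Lemma bnd_shift h a M : bnd h M -> bnd (fun n => h (n + a)) M.
Proof. by move=> hM x k; rewrite win_shift; exact: hM. Qed.

Lemma bnd_le h f M : (forall n, h n <= f n) -> bnd f M -> bnd h M.
Proof. by move=> hf fM x k; apply: le_trans (fM x k); apply: ler_sum. Qed.

Lemma bnd_weaken h M M' : M <= M' -> bnd h M -> bnd h M'.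
Proof. by move=> MM hM x k; apply: le_trans (hM x k) MM. Qed.

Lemma bndD h f M M' : bnd h M -> bnd f M' -> bnd (fun n => h n + f n) (M + M').
Proof.
by move=> hM fM x k; rewrite /win big_split; apply: lerD; [exact: hM|exact: fM].
Qed.

Lemma bndZ h (c M : R) : 0 <= c -> bnd h M -> bnd (fun n => c * h n) (c * M).
Proof.
by move=> c0 hM x k; rewrite /win -mulr_sumr; apply: ler_wpM2l => //; exact: hM.
Qed.

Lemma bnd_sum (I : finType) (h : I -> int -> R) (M : I -> R) :
  (forall i, bnd (h i) (M i)) -> bnd (fun n => \sum_i h i n) (\sum_i M i).
Proof.
by move=> hM x k; rewrite /win exchange_big; apply: ler_sum => i _; apply: hM.
Qed.

Lemma bnd_ge0 h M : bnd h M -> 0 <= M.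
Proof. by move=> /(_ 0 0%N); rewrite /win big_ord0. Qed.

Lemma win1 h x : win h x 1 = h x.
Proof. by rewrite /win big_ord1 addr0. Qed.

Lemma bnd_point h M n : bnd h M -> h n <= M.
Proof. by move=> /(_ n 1%N); rewrite win1. Qed.

Lemma winD h x k k' : win h x (k + k') = win h x k + win h (x + k%:Z) k'.
Proof.
by rewrite /win big_split_ord; congr (_ + _); apply: eq_bigr => i _ /=;
  rewrite ?PoszD ?addrA.
Qed.

Lemma win_ge0 h x k : (forall n, 0 <= h n) -> 0 <= win h x k.
Proof. by move=> h0; apply: sumr_ge0. Qed.

Definition box h K := win h (- K%:Z) (K + K).

Lemma win_box h x k K : (forall n, 0 <= h n) ->
  - K%:Z <= x -> x + k%:Z <= K%:Z -> win h x k <= box h K.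
Proof.
move=> h0 Kx xK.
have [a ea] : exists a : nat, x = - K%:Z + a%:Z by exists (absz (x + K%:Z)); lia.
have [b eb] : exists b : nat, (K + K = a + (k + b))%N.
  by exists (K + K - (a + k))%N; lia.
rewrite /box eb !winD -ea.
have := win_ge0 h (- K%:Z) a h0; have := win_ge0 h (x + k%:Z) b h0; lra.
Qed.

Definition nsup h : R := sup [set v | exists x k, v = win h x k].

Lemma nsup_bnd h M : bnd h M -> bnd h (nsup h).
Proof.
move=> hM x k; apply: ub_le_sup; last by exists x, k.
by exists M => _ [y [j ->]]; apply: hM.
Qed.

Lemma nsup_le h M : bnd h M -> nsup h <= M.
Proof.
move=> hM; apply: ge_sup; last by move=> _ [y [j ->]]; apply: hM.
by exists (win h 0 0), 0, 0%N.
Qed.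

Lemma near_win_box h x k : (forall n, 0 <= h n) ->
  \forall K \near \oo, win h x k <= box h K.
Proof.
move=> h0; near=> K; apply: win_box => //.
- have : (absz x <= K)%N by near: K; exact: nbhs_infty_ge.
  by lia.
- have : (absz (x + k%:Z)%R <= K)%N by near: K; exact: nbhs_infty_ge.
  by lia.
Unshelve. all: by end_near. Qed.

Lemma near_nsup h M (e : R) : (forall n, 0 <= h n) -> bnd h M -> 0 < e ->
  \forall K \near \oo, nsup h - e <= box h K.
Proof.
move=> h0 hM e0.
have [|_ [x [k ->]] lt] := @sup_adherent _ [set v | exists x k, v = win h x k] e e0.
  split; first by exists (win h 0 0), 0, 0%N.
  by exists M => _ [y [j ->]]; apply: hM.
have := near_win_box h x k h0; apply: filterS => K; apply: le_trans.
exact: ltW.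
Qed.

Lemma near_small h M (e : R) : (forall n, 0 <= h n) -> bnd h M -> 0 < e ->
  \forall K \near \oo, forall n, (K <= `|n|)%N -> h n <= e.
Proof.
move=> h0 hM e0; have [K0 _ hK0] := near_nsup h M e h0 hM e0.
near=> K => n Kn.
have K0K : (K0 + 1 <= K)%N by near: K; exact: nbhs_infty_ge.
have b := hK0 K0 (leqnn _); have bs := nsup_bnd _ _ hM.
have [n0|n0] := leP 0 n.
  have [d ed] : exists d : nat, n = K0%:Z + d%:Z by exists (absz (n - K0%:Z)%R); lia.
  have := bs (- K0%:Z) (K0 + K0 + (d + 1))%N.
  rewrite winD (winD _ _ d) win1 -/(box h K0).
  rewrite (_ : - K0%:Z + (K0 + K0)%N%:Z + d%:Z = n); last by lia.
  have := win_ge0 h (- K0%:Z + (K0 + K0)%N%:Z) d h0; lra.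
have [d ed] : exists d : nat, - K0%:Z = n + 1 + d%:Z.
  by exists (absz (- n - 1 - K0%:Z)%R); lia.
have := bs n (1 + (d + (K0 + K0)))%N.
rewrite (winD _ _ 1) (winD _ _ d) win1 -ed -/(box h K0).
have := win_ge0 h (n + 1%:Z) d h0; lra.
Unshelve. all: by end_near. Qed.

(* The least bound a' of h satisfies a' <= a + a' / 2. *)
Lemma bnd_ind h (a : R) : (forall n, 0 <= h n) ->
  (forall M, bnd h M -> bnd h (a + M / 2)) ->
  forall M, bnd h M -> bnd h (2 * a).
Proof.
move=> h0 step M hM; have hs := nsup_bnd _ _ hM.
have := nsup_le _ _ (step _ hs).
by move=> le; apply: bnd_weaken hs; lra.
Qed.

End WindowSums.

Section Jacobi.
Context {R : realType}.
Implicit Types (W psi phi f g r : int -> R) (E M : R) (x n : int) (k K : nat).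

Definition jac E W psi n : R := (E - W n) * psi n - psi (n - 1) - psi (n + 1).

Definition sq f : int -> R := fun n => f n ^+ 2.

Lemma sq_ge0 f n : 0 <= sq f n. Proof. exact: sqr_ge0. Qed.
Hint Resolve sq_ge0 : core.

Lemma bnd_sqD f g M M' : bnd (sq f) M -> bnd (sq g) M' ->
  bnd (sq (fun n => f n + g n)) (2 * M + 2 * M').
Proof.
move=> fM gM; have h2 : 0 <= 2 :> R by lra.
apply: bnd_le (bndD _ _ _ _ (bndZ _ 2 _ h2 fM) (bndZ _ 2 _ h2 gM)) => n.
rewrite /sq /=; have := sqr_ge0 (f n - g n); nra.
Qed.

Lemma bnd_sqZ f (c M : R) : bnd (sq f) M ->
  bnd (sq (fun n => c * f n)) (c ^+ 2 * M).
Proof.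
move=> fM; apply: bnd_le (bndZ _ _ _ (sqr_ge0 c) fM) => n.
by rewrite /sq exprMn.
Qed.

Lemma bnd_jac E W psi M : (forall n, `|E - W n| <= 6) -> bnd (sq psi) M ->
  bnd (sq (jac E W psi)) (114 * M).
Proof.
move=> EW pM.
have -> : 114 * M = 108 * M + 3 * M + 3 * M by ring.
have h108 : 0 <= 108 :> R by lra. have h3 : 0 <= 3 :> R by lra.
apply: bnd_le (bndD _ _ _ _ (bndD _ _ _ _ (bndZ _ _ _ h108 pM)
  (bndZ _ _ _ h3 (bnd_shift _ (-1) _ pM))) (bndZ _ _ _ h3 (bnd_shift _ 1 _ pM))).
move=> n; rewrite /sq /jac /=; have := EW n; rewrite ler_norml.
move: (E - W n) (psi n) (psi (n - 1)) (psi (n + 1)) => a b c d ha.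
have ha2 : a ^+ 2 <= 36 by nra.
have : (a * b) ^+ 2 <= 36 * b ^+ 2 by rewrite exprMn; apply: ler_wpM2r ha2; exact: sqr_ge0.
move: (a * b) => z hz.
have := sqr_ge0 (z + c); have := sqr_ge0 (z + d); have := sqr_ge0 (c - d); nra.
Qed.

Definition wronskian psi phi n : R := psi n * phi (n + 1) - phi n * psi (n + 1).

Lemma win_green E E' W psi phi x k :
  win (fun n => jac E W psi n * phi n - jac E' W phi n * psi n) x k =
  (E - E') * win (fun n => psi n * phi n) x k
  + wronskian psi phi (x + k%:Z - 1) - wronskian psi phi (x - 1).
Proof.
elim: k => [|k IH].
  by rewrite /win !big_ord0 mulr0 addr0 add0r subrr.
have s h : win h x k.+1 = win h x k + h (x + k%:Z) :> R by rewrite -addn1 winD win1.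
rewrite !s IH mulrDr.
have -> : x + k.+1%:Z - 1 = x + k%:Z by lia.
by rewrite /jac /wronskian subrK; ring.
Qed.

Lemma wronskian_small psi phi M M' (e : R) : bnd (sq psi) M -> bnd (sq phi) M' ->
  0 < e -> \forall K \near \oo,
   `|wronskian psi phi (- K%:Z + (K + K)%N%:Z - 1) - wronskian psi phi (- K%:Z - 1)|
     <= e.
Proof.
move=> pM fM e0; have e4 : 0 < e / 4 by lra.
have hp := near_small _ _ _ (sq_ge0 psi) pM e4.
have hf := near_small _ _ _ (sq_ge0 phi) fM e4.
near \oo => K1.
have hp' n : (K1 <= `|n|)%N -> sq psi n <= e / 4.
  by move: n; near: K1; exact: hp.
have hf' n : (K1 <= `|n|)%N -> sq phi n <= e / 4.
  by move: n; near: K1; exact: hf.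
have hw n : (K1 <= `|n|)%N -> (K1 <= absz (n + 1)%R)%N -> `|wronskian psi phi n| <= e / 2.
  move=> n1 n2; have := hp' _ n1; have := hp' _ n2; have := hf' _ n1; have := hf' _ n2.
  rewrite /sq /wronskian; move: (psi n) (psi (n + 1)) (phi n) (phi (n + 1)) => a b c d.
  have := sqr_ge0 (a + d); have := sqr_ge0 (a - d).
  have := sqr_ge0 (b + c); have := sqr_ge0 (b - c).
  by rewrite !sqrrD !sqrrN !mulrN ler_norml => *; apply/andP; split; lra.
near=> K.
have KK : (K1 + 1 <= K)%N by near: K; exact: nbhs_infty_ge.
apply: le_trans (ler_normB _ _) _.
have : `|wronskian psi phi (- K%:Z + (K + K)%N%:Z - 1)| <= e / 2.
  by apply: hw; lia.
have : `|wronskian psi phi (- K%:Z - 1)| <= e / 2 by apply: hw; lia.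
by lra.
Unshelve. all: by end_near. Qed.

Section Inversion.
Variables (E : R) (W : int -> R) (kappa : R).
Hypothesis EW : forall n, `|E - W n| <= 6.
Hypothesis kappa_ge1 : 1 <= kappa.
Hypothesis below : forall psi M M', bnd (sq psi) M ->
  bnd (sq (jac E W psi)) M' -> bnd (sq psi) (kappa * M').

Local Notation A := (jac E W).

Let kappa_gt0 : 0 < kappa. Proof. exact: lt_le_trans ltr01 kappa_ge1. Qed.

(* A step of gradient descent for |A u - f|^2: as <r, A (A r)> = |A r|^2, it
   contracts the residual by means of the lower bound on A alone. *)
Definition resid r n := r n - 114^-1 * A (A r) n.

Lemma bnd_resid r M : bnd (sq r) M -> bnd (sq (resid r)) ((1 - 114^-1 / kappa) * M).
Proof.
move=> rM; have gM := bnd_jac _ _ _ _ EW rM.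
set g := A r in gM; have AgM := bnd_jac _ _ _ _ EW (nsup_bnd _ _ gM).
set G := nsup (sq g) in AgM; have rG := below _ _ _ rM (nsup_bnd _ _ gM).
have rs := nsup_bnd _ _ rM; set N := nsup (sq r) in rs.
have NM : N <= M by exact: nsup_le rM.
have NG : N <= kappa * G by exact: nsup_le rG.
have key x k : win (sq (resid r)) x k <= N - 114^-1 * G.
  apply/ler_addgt0Pr => e e0.
  have b1 := near_win_box _ x k (sq_ge0 (resid r)).
  have b2 := near_nsup _ _ _ (sq_ge0 g) gM e0.
  have b3 := wronskian_small _ _ _ _ _ gM rM e0.
  near \oo => K.
  have c1 : win (sq (resid r)) x k <= box (sq (resid r)) K.
    by near: K; exact: b1.
  have c2 : G - e <= box (sq g) K by near: K; exact: b2.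
  have : `|wronskian g r (- K%:Z + (K + K)%N%:Z - 1) - wronskian g r (- K%:Z - 1)|
     <= e by near: K; exact: b3.
  have := win_green E E W g r (- K%:Z) (K + K).
  rewrite subrr mul0r add0r -/(box _ _) => <-.
  rewrite ler_norml => /andP[c3 c4].
  have eq : box (sq (resid r)) K = box (sq r) K - 2 / 114 * box (sq g) K
     + (114^-1) ^+ 2 * box (sq (A g)) K
     - 2 / 114 * box (fun n => A g n * r n - A r n * g n) K.
    rewrite /box /win !mulr_sumr -!sumrB -big_split -sumrB/=.
    by apply: eq_bigr => i _; rewrite /sq /resid -/g; ring.
  have b5 : box (sq r) K <= N by exact: rs.
  have b6 : box (sq (A g)) K <= 114 * G by exact: AgM.
  lra.
move=> x k; apply: le_trans (key x k) _.
have : N / kappa <= G by rewrite ler_pdivrMr// mulrC.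
have : (114^-1 / kappa) * N = 114^-1 * (N / kappa) by rewrite mulrAC mulrA.
have k1 : 0 <= 1 - 114^-1 / kappa.
  by have : kappa^-1 <= 1 by [rewrite invf_le1]; lra.
have : (1 - 114^-1 / kappa) * N <= (1 - 114^-1 / kappa) * M by exact: ler_wpM2l.
lra.
Unshelve. all: by end_near. Qed.

Lemma jac_surj f M : bnd (sq f) M ->
  exists2 u, (exists M', bnd (sq u) M') & forall n, A u n = f n.
Proof.
move=> fM.
pose q := 1 - 114^-1 / kappa.
have ki : 0 <= kappa^-1 <= 1 by rewrite invr_ge0 invf_le1// ltW.
have ki0 : 0 < kappa^-1 by rewrite invr_gt0.
have q0 : 0 <= q by rewrite /q; lra.
have q1 : q < 1 by rewrite /q; lra.
pose r k := iter k resid f.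
pose u k n := \sum_(i < k) 114^-1 * A (r i) n.
have rM k : bnd (sq (r k)) (q ^+ k * M).
  elim: k => [|k IH]; first by rewrite expr0 mul1r.
  by rewrite exprS -mulrA; exact: bnd_resid.
have uS k n : u k.+1 n = u k n + 114^-1 * A (r k) n by rewrite /u big_ord_recr.
have Au k n : A (u k) n = f n - r k n.
  elim: k n => [|k IH] n; first by rewrite subrr /jac /u !big_ord0; ring.
  have -> : A (u k.+1) n = A (u k) n + 114^-1 * A (A (r k)) n.
    by rewrite /jac !uS; rewrite /jac; ring.
  by rewrite IH /r iterS -/(r k) /resid; ring.
have ul2 k : exists M', bnd (sq (u k)) M'.
  elim: k => [|k [M' IH]].
    exists 0 => x k; rewrite /win big1// => i _; rewrite /sq /u big_ord0.
    by rewrite expr0n.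
  exists (2 * M' + 2 * ((114^-1) ^+ 2 * (114 * (q ^+ k * M)))).
  have h := bnd_sqD _ _ _ _ IH (bnd_sqZ _ (114^-1) _ (bnd_jac _ _ _ _ EW (rM k))).
  by apply: bnd_le h => n; rewrite /sq uS.
have M0 := bnd_ge0 _ _ fM.
have qk k : 0 <= q ^+ k <= 1 by rewrite exprn_ge0// exprn_ile1// ltW.
have uB k : bnd (sq (u k)) (kappa * (4 * M)).
  have [M' hM'] := ul2 k; apply: below hM' _.
  have rk := bnd_sqZ _ (-1) _ (rM k).
  apply: bnd_weaken (bnd_le _ _ _ _ (bnd_sqD _ _ _ _ fM rk)) => [|n].
    by have := qk k; move: (q ^+ k) => z hz; nra.
  by rewrite /sq Au /= mulN1r.
have geo (k : nat) (y : R) : y ^+ 2 <= q ^+ k * M ->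
    `|y| <= geometric (Num.sqrt M) (Num.sqrt q) k.
  move=> h; have z0 : 0 <= geometric (Num.sqrt M) (Num.sqrt q) k.
    by rewrite /geometric /= mulr_ge0 ?exprn_ge0 ?sqrtr_ge0.
  rewrite -ler_sqr ?nnegrE// real_normK ?num_real// (le_trans h)//.
  by rewrite /geometric /= exprMn -exprM mulnC exprM !sqr_sqrtr// mulrC.
have sq1 : `|Num.sqrt q| < 1.
  by rewrite ger0_norm ?sqrtr_ge0// -sqrtr1 ltr_sqrt.
have cv n : cvgn (u ^~ n).
  have -> : u ^~ n = series (fun k => 114^-1 * A (r k) n).
    by apply/funext => k; rewrite /u /series /= big_mkord.
  apply: normed_cvg; rewrite /=.
  apply: (@series_le_cvg _ _ (geometric (Num.sqrt M) (Num.sqrt q))).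
  - by move=> k; exact: normr_ge0.
  - by move=> k; apply: le_trans (geo k 0 _); rewrite ?expr0n//= mulr_ge0//;
      have /andP[] := qk k.
  - move=> k; apply: geo.
    have := bnd_point _ _ n (bnd_jac _ _ _ _ EW (rM k)).
    have : 0 <= q ^+ k * M by rewrite mulr_ge0//; have /andP[] := qk k.
    by rewrite /sq /= exprMn; lra.
  - exact: is_cvg_geometric_series.
exists (fun n => limn (u ^~ n)).
  exists (kappa * (4 * M)) => x k.
  have cs : (fun K => win (sq (u K)) x k) @ \oo -->
     win (sq (fun n => limn (u ^~ n))) x k.
    apply: cvg_big => [|i _]; first exact: add_continuous.
    by apply: cvgM; exact: cv.
  rewrite -(cvg_lim _ cs)//; apply: limr_le; first by apply/cvg_ex; eexists; exact: cs.
  by near=> K; exact: uB.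
move=> n.
have h1 : (fun k => A (u k) n) @ \oo --> A (fun n => limn (u ^~ n)) n.
  by apply: cvgB; [apply: cvgB; [apply: cvgMl_tmp|]|]; exact: cv.
have h2 : (fun k => A (u k) n) @ \oo --> f n - 0.
  have -> : (fun k => A (u k) n) = (fun k => f n - r k n).
    by apply/funext => k; exact: Au.
  apply: cvgB; first exact: cvg_cst.
  apply: norm_cvg0; apply: (squeeze_cvgr _ (cvg_cst 0) (cvg_geometric (Num.sqrt M) sq1)).
  by near=> k; rewrite normr_ge0 /=; apply: geo; exact: bnd_point (rM k).
rewrite subr0 in h2; rewrite -(cvg_lim _ h1)//; exact: cvg_lim h2.
Unshelve. all: by end_near. Qed.

End Inversion.

End Jacobi.

(** * The resolvent set and lower bounds *)

Section Ell2.
Context {R : realType}.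
Implicit Types (h u v : int -> R) (psi phi : int -> R[i]) (M : R).

Definition window (x : int) k : seq int := [seq x + i%:Z | i <- iota 0 k].

Lemma fsum_window h x k :
  (\sum_(n \in [set` window x k]) (h n)%:E)%E
  = (win h x k)%:E.
Proof.
rewrite -fsbig_seq; last by rewrite map_inj_uniq ?iota_uniq// => i j /addrI [].
by rewrite big_map sumEFin /win -{1}(subn0 k) -/(index_iota 0 k) big_mkord.
Qed.

Lemma esum_le_bnd h M : (forall n, 0 <= h n) ->
  (\esum_(n in [set: int]) (h n)%:E <= M%:E)%E <-> bnd h M.
Proof.
move=> h0; split => [hM x k|hM].
  rewrite -lee_fin -fsum_window; apply: le_trans hM.
  apply: esum_ge; exists [set` window x k] => //.
  by split => //; exact: finite_seq.
apply: ge_ereal_sup => _ [A [finA _] <-].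
have [K AK] : exists K : nat, forall n, A n -> (`|n| < K)%N.
  have /finite_seqP[s ->] := finA.
  exists (\max_(n <- s) `|n|).+1%N => n /= ns.
  by rewrite ltnS (big_rem _ ns) leq_maxl.
apply: (@le_trans _ _ (\sum_(n \in [set` window (- K%:Z)%R (K + K)]) (h n)%:E)%E).
  apply: lee_fsum_nneg_subset => //; first exact: finite_seq.
  - move=> n; rewrite !inE /= => /AK nK.
    apply/mapP; exists (absz (n + K%:Z)%R); last by lia.
    by rewrite mem_iota; lia.
  - by move=> n _; rewrite lee_fin.
by rewrite fsum_window lee_fin; exact: hM.
Qed.

Lemma esum_nsup h M : (forall n, 0 <= h n) -> bnd h M ->
  \esum_(n in [set: int]) (h n)%:E = (nsup h)%:E.
Proof.
move=> h0 hM; have hs := nsup_bnd _ _ hM.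
have le : (\esum_(n in [set: int]) (h n)%:E <= (nsup h)%:E)%E by apply/esum_le_bnd.
have ge : (0 <= \esum_(n in [set: int]) (h n)%:E)%E.
  by apply: esum_ge0 => n _; rewrite lee_fin.
move: le ge; case E : (\esum_(n in _) _) => [r| |] // le ge.
apply/eqP; rewrite eq_le le lee_fin nsup_le//.
by apply/esum_le_bnd; rewrite // E.
Qed.

Definition cseq u v : int -> R[i] := fun n => (u n +i* v n)%C.

Definition re psi n : R := complex.Re (psi n).
Definition im psi n : R := complex.Im (psi n).

Lemma cseqE psi : psi = cseq (re psi) (im psi).
Proof. by apply/funext => n; rewrite /cseq /re /im; case: (psi n). Qed.

Definition csq u v n := sq u n + sq v n.

Lemma csq_ge0 u v n : 0 <= csq u v n.
Proof. by rewrite addr_ge0// sq_ge0. Qed.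
Hint Resolve csq_ge0 : core.

Lemma normc_cseq u v n : ComplexField.Normc.normc (cseq u v n) ^+ 2 = csq u v n.
Proof. by rewrite /= sqr_sqrtr// csq_ge0. Qed.

Lemma l2norm_cseq u v M : bnd (csq u v) M ->
  l2norm (cseq u v) = (Num.sqrt (nsup (csq u v)))%:E.
Proof.
move=> h; rewrite /l2norm.
under eq_esum do rewrite normc_cseq.
by rewrite (esum_nsup _ M).
Qed.

Lemma ell2_cseq u v : ell2 (cseq u v) <-> exists M, bnd (csq u v) M.
Proof.
split => [|[M h]]; last by rewrite /ell2 /= (l2norm_cseq _ _ M)// ltry.
rewrite /ell2 /= /l2norm; under eq_esum do rewrite normc_cseq.
have ge : (0 <= \esum_(n in [set: int]) (csq u v n)%:E)%E.
  by apply: esum_ge0 => n _; rewrite lee_fin.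
move: ge; case E : (\esum_(n in _) _) => [r| |] // _ _.
by exists r; apply/esum_le_bnd; rewrite // E.
Qed.

Lemma ell2_cseqP u v : ell2 (cseq u v) <->
  (exists M, bnd (sq u) M) /\ (exists M, bnd (sq v) M).
Proof.
rewrite ell2_cseq; split => [[M h]|[[M h] [M' h']]].
  by split; exists M; apply: bnd_le h => n; rewrite ?lerDl ?lerDr sq_ge0.
by exists (M + M'); apply: bndD.
Qed.

End Ell2.

Section Resolvent.
Context {R : realType}.
Variables (E : R) (W : int -> R).
Implicit Types (u v f : int -> R) (psi phi : int -> R[i]) (M : R).

Definition bounded_below (kappa : R) := forall u M M',
  bnd (sq u) M -> bnd (sq (jac E W u)) M' -> bnd (sq u) (kappa * M').

Lemma sub_scalar_cseq u v :
  sub_scalar (schroedinger W) E%:C%C (cseq u v) =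
  cseq (fun n => - jac E W u n) (fun n => - jac E W v n).
Proof.
apply/funext => n; rewrite /sub_scalar /schroedinger /cseq /jac.
by apply/eqP; rewrite eq_complex /=; apply/andP; split; apply/eqP; ring.
Qed.

Hypothesis EW : forall n, `|E - W n| <= 6.

Lemma resolvent_bounded_below : resolvent_set (schroedinger W) E%:C%C ->
  exists2 kappa, 0 <= kappa & bounded_below kappa.
Proof.
move=> [T [[_ [m Tm]] Tinv]]; exists (m ^+ 2); first exact: sqr_ge0.
move=> u M M' uM AuM.
pose z : int -> R := fun=> 0.
have csq0 f : csq f z = sq f by apply/funext => n; rewrite /csq /sq /z expr0n addr0.
pose f n := - jac E W u n.
have sqf : sq f = sq (jac E W u) by apply/funext => n; rewrite /sq /f sqrrN.
have e : sub_scalar (schroedinger W) E%:C%C (cseq u z) = cseq f z.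
  rewrite sub_scalar_cseq; congr cseq; apply/funext => n.
  by rewrite /jac /z mulr0 !subrr oppr0.
have u2 : ell2 (cseq u z) by apply/ell2_cseq; exists M; rewrite csq0.
have f2 : ell2 (cseq f z) by apply/ell2_cseq; exists M'; rewrite csq0 sqf.
have [Tu _] := Tinv _ u2.
have := Tm _ f2; rewrite -e Tu e (l2norm_cseq _ _ M) ?csq0//.
rewrite (l2norm_cseq _ _ M') ?csq0 ?sqf// -EFinM lee_fin => le.
have s0 g M0 : bnd (sq g) M0 -> 0 <= nsup (sq g) by move=> /nsup_bnd/bnd_ge0.
apply: bnd_weaken (nsup_bnd _ _ uM).
rewrite -(sqr_sqrtr (s0 _ _ uM)).
apply: (@le_trans _ _ ((m * Num.sqrt (nsup (sq (jac E W u)))) ^+ 2)).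
  by rewrite ler_sqr ?nnegrE ?sqrtr_ge0// (le_trans _ le)// sqrtr_ge0.
rewrite exprMn sqr_sqrtr; last exact: s0 AuM.
by apply: ler_wpM2l; [exact: sqr_ge0 | exact: nsup_le].
Qed.

Section BoundedBelow.
Variable kappa : R.
Hypothesis kappa_ge1 : 1 <= kappa.
Hypothesis below : bounded_below kappa.

Definition inv_spec f u :=
  (exists M, bnd (sq u) M) /\ forall n, jac E W u n = - f n.

Definition inv f : int -> R := xget (fun=> 0) [set u | inv_spec f u].

Lemma inv_spec_uniq f u v : inv_spec f u -> inv_spec f v -> u = v.
Proof.
move=> [[M uM] uf] [[M' vM] vf].
pose d n := u n + -1 * v n.
have dM := bnd_sqD _ _ _ _ uM (bnd_sqZ _ (-1) _ vM).
have A0 : bnd (sq (jac E W d)) 0.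
  move=> x k; rewrite /win big1// => i _; rewrite /sq.
  have -> : jac E W d (x + i%:Z) = jac E W u (x + i%:Z) - jac E W v (x + i%:Z).
    by rewrite /jac /d; ring.
  by rewrite uf vf subrr expr0n.
have d0 := below _ _ _ dM A0.
apply/funext => n; have := bnd_point _ _ n d0.
rewrite mulr0 /sq exprn_even_le0//= /d mulN1r subr_eq0 => /eqP //.
Qed.

Lemma invP f M : bnd (sq f) M -> inv_spec f (inv f).
Proof.
move=> fM; have fM' := bnd_sqZ _ (-1) _ fM.
have [u uM uf] := jac_surj E W kappa EW kappa_ge1 below _ _ fM'.
have : inv_spec f u by split=> // n; rewrite uf mulN1r.
by move=> h; rewrite /inv; case: xgetP => // /(_ _ h).
Qed.

Lemma inv_bnd f M : bnd (sq f) M -> bnd (sq (inv f)) (kappa * M).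
Proof.
move=> fM; have [[M' hM'] h] := invP _ _ fM.
apply: below hM' _; apply: bnd_le fM => n.
by rewrite /sq h sqrrN.
Qed.

Lemma bounded_below_resolvent : resolvent_set (schroedinger W) E%:C%C.
Proof.
pose T psi := cseq (inv (re psi)) (inv (im psi)).
have split2 psi : ell2 psi ->
    (exists M, bnd (sq (re psi)) M) /\ (exists M, bnd (sq (im psi)) M).
  by rewrite {1}(cseqE psi) => /ell2_cseqP.
exists T; split; last first.
  move=> psi /split2[[M rM] [M' iM]]; split.
    rewrite [in LHS](cseqE psi) sub_scalar_cseq /T [RHS]cseqE.
    have key u M0 : bnd (sq u) M0 -> inv (fun n => - jac E W u n) = u.
      move=> uM0; have s : inv_spec (fun n => - jac E W u n) u.
        by split; [exists M0 | move=> n; rewrite opprK].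
      apply: inv_spec_uniq s; apply: invP.
      apply: bnd_le (bnd_jac _ _ _ _ EW uM0) => n.
      by rewrite /sq sqrrN.
    congr cseq; [exact: key rM|exact: key iM].
  rewrite /T sub_scalar_cseq [RHS]cseqE.
  have [_ r1] := invP _ _ rM; have [_ i1] := invP _ _ iM.
  by congr cseq; apply/funext => n; rewrite ?r1 ?i1 opprK.
split.
  move=> a psi phi /split2[[M1 rM] [M2 iM]] /split2[[M3 rM'] [M4 iM']].
  have [[N1 rN] rA] := invP _ _ rM; have [[N2 iN] iA] := invP _ _ iM.
  have [[N3 rN'] rA'] := invP _ _ rM'; have [[N4 iN'] iA'] := invP _ _ iM'.
  have comb (c d : R) (f g h : int -> R) F G H :
     inv_spec f F -> inv_spec g G -> inv_spec h H ->
     inv_spec (fun n => c * f n + d * g n + h n) (fun n => c * F n + d * G n + H n).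
    move=> [[K1 b1] s1] [[K2 b2] s2] [[K3 b3] s3]; split.
      eexists; apply: bnd_sqD b3.
      by apply: bnd_sqD; [exact: bnd_sqZ b1|exact: bnd_sqZ b2].
    move=> n.
    have -> : jac E W (fun n => c * F n + d * G n + H n) n =
       c * jac E W F n + d * jac E W G n + jac E W H n by rewrite /jac; ring.
    by rewrite s1 s2 s3; ring.
  have I f u : inv_spec f u -> inv f = u.
    move=> s; apply: (inv_spec_uniq f) => //.
    by rewrite /inv; case: xgetP => // /(_ _ s).
  have s1 := invP _ _ rM; have s2 := invP _ _ iM.
  have s3 := invP _ _ rM'; have s4 := invP _ _ iM'.
  have c1 := comb (complex.Re a) (- complex.Im a) _ _ _ _ _ _ s1 s2 s3.
  have c2 := comb (complex.Im a) (complex.Re a) _ _ _ _ _ _ s1 s2 s4.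
  have e1 : re (fun n => a * psi n + phi n) =
     fun n => complex.Re a * re psi n + - complex.Im a * im psi n + re phi n.
    apply/funext => n; rewrite /re /im; case: (a) => a1 a2; case: (psi n) => b1 b2.
    by case: (phi n) => d1 d2 /=; ring.
  have e2 : im (fun n => a * psi n + phi n) =
     fun n => complex.Im a * re psi n + complex.Re a * im psi n + im phi n.
    apply/funext => n; rewrite /re /im; case: (a) => a1 a2; case: (psi n) => b1 b2.
    by case: (phi n) => d1 d2 /=; ring.
  rewrite /T e1 e2 (I _ _ c1) (I _ _ c2); apply/funext => n; rewrite /cseq.
  case: (a) => a1 a2.
  by apply/eqP; rewrite eq_complex /=; apply/andP; split; apply/eqP; ring.
exists (Num.sqrt (2 * kappa)) => psi psi2; rewrite {2}(cseqE psi).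
have [M b] : exists M, bnd (csq (re psi) (im psi)) M.
  by apply/ell2_cseq; rewrite -cseqE.
have bs := nsup_bnd _ _ b; set N := nsup _ in bs.
have rN : bnd (sq (re psi)) N by apply: bnd_le bs => n; rewrite lerDl sq_ge0.
have iN : bnd (sq (im psi)) N by apply: bnd_le bs => n; rewrite lerDr sq_ge0.
have TN := bndD _ _ _ _ (inv_bnd _ _ rN) (inv_bnd _ _ iN).
rewrite /T (l2norm_cseq _ _ _ TN) (l2norm_cseq _ _ _ b) -/N -EFinM lee_fin.
have k1 := kappa_ge1; rewrite -sqrtrM; last by rewrite mulr_ge0//; lra.
apply: ler_wsqrtr; apply: le_trans (nsup_le _ _ TN) _; lra.
Qed.

End BoundedBelow.

End Resolvent.

(** * Elimination of a half line *)

Section HalfLine.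
Context {R : realType}.
Implicit Types (q x : nat -> R) (E : R).

Lemma geom_sum_le (D : nat) : \sum_(i < D) 4^-1 ^+ i.+1 <= 3^-1 :> R.
Proof.
suff -> : \sum_(i < D) 4^-1 ^+ i.+1 = (1 - 4^-1 ^+ D) / 3 :> R.
  have : 0 <= 4^-1 ^+ D :> R by apply: exprn_ge0; lra.
  lra.
elim: D => [|D IH]; first by rewrite big_ord0 expr0 subrr mul0r.
by rewrite big_ord_recr /= IH exprS; field.
Qed.

(* One site of the half line shrinks the defect x 1 - cf E q * x 0 by the factor
   cf E q <= 1/3. *)
Lemma half_line E q x y D : 4 <= E -> wellpot q ->
  (forall i, y i = (E - q i) * x i.+1 - x i - x i.+2) ->
  (x 1%N - cf E q * x 0%N) ^+ 2 <=
  \sum_(i < D) 4^-1 ^+ i.+1 * y i ^+ 2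
  + 4^-1 ^+ D * (2 * (x D.+1 ^+ 2 + x D ^+ 2)).
Proof.
move=> E4; elim: D q x y => [|D IH] q x y qw yE.
  rewrite big_ord0 add0r expr0 mul1r; have := cf_bounds E q E4 qw.
  move: (cf _ _) (x 1%N) (x 0%N) => m a b hm.
  have : (m * b) ^+ 2 <= b ^+ 2.
    by rewrite exprMn ler_piMl ?sqr_ge0// expr_le1//; lra.
  move: (m * b) => z; have := sqr_ge0 (a + z); lra.
have -> : \sum_(i < D.+1) 4^-1 ^+ i.+1 * y i ^+ 2 =
   4^-1 * (y 0%N ^+ 2 + \sum_(i < D) 4^-1 ^+ i.+1 * y i.+1 ^+ 2).
  rewrite big_ord_recl mulrDr expr1 mulr_sumr; congr (_ + _).
  by apply: eq_bigr => i _; rewrite /= /bump /= add1n exprS mulrA.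
have qw1 := wellpot_qshift 1 _ qw.
have := IH (qshift 1 q) (fun i => x i.+1) (fun i => y i.+1) qw1 (fun i => yE i.+1).
have eqm := cf_eq E q E4 qw; have := cf_bounds E q E4 qw.
rewrite [4^-1 ^+ D.+1]exprS -mulrA; set T := 4^-1 ^+ D * _.
move: (\sum_(i < D) _) => S; rewrite (yE 0%N); move: eqm.
move: T (cf E q) (cf E (qshift 1 q)) (x 0%N) (x 1%N) (x 2%N) (E - q 0%N).
move=> T m m1 x0 x1 x2 z eqm hm hd.
have -> : x1 - m * x0 = m * (z * x1 - x0 - x2 + (x2 - m1 * x1)).
  have -> : x1 - m * x0 = m * (z - m1) * x1 - m * x0 by rewrite eqm mul1r.
  ring.
move: hd; set d := x2 - _; set w := z * x1 - x0 - x2 => hd.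
rewrite exprMn; have m2 : m ^+ 2 <= 9^-1 by nra.
have := ler_wpM2r (sqr_ge0 (w + d)) m2; have := sqr_ge0 (w - d).
have := sqr_ge0 w; have := sqr_ge0 d; lra.
Qed.

(* Eliminating both sides of n turns the equation at n into
   secular E q q' * psi n = f n + the two defects of half_line. *)
Lemma well_site E (q q' : nat -> R) (psi f : int -> R) n D c :
  4 <= E -> wellpot q -> wellpot q' -> 0 <= c -> c <= `|secular E q q'| ->
  f n = (E - 4) * psi n - psi (n - 1) - psi (n + 1) ->
  (forall i, (i < D)%N -> f (n + i.+1%:Z) =
    (E - q i) * psi (n + i.+1%:Z) - psi (n + i%:Z) - psi (n + i.+2%:Z)) ->
  (forall i, (i < D)%N -> f (n - i.+1%:Z) =
    (E - q' i) * psi (n - i.+1%:Z) - psi (n - i%:Z) - psi (n - i.+2%:Z)) ->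
  c ^+ 2 * sq psi n <= 3 * sq f n
    + 3 * \sum_(i < D) 4^-1 ^+ i.+1 * (sq f (n + i.+1%:Z) + sq f (n - i.+1%:Z))
    + 6 * 4^-1 ^+ D * (sq psi (n + D.+1%:Z) + sq psi (n + D%:Z)
                       + (sq psi (n - D.+1%:Z) + sq psi (n - D%:Z))).
Proof.
move=> E4 qw qw' c0 cF fn fr fl.
have := half_line E q (fun i => psi (n + i%:Z))
  (fun i => (E - q i) * psi (n + i.+1%:Z) - psi (n + i%:Z) - psi (n + i.+2%:Z))
  D E4 qw (fun=> erefl).
have := half_line E q' (fun i => psi (n - i%:Z))
  (fun i => (E - q' i) * psi (n - i.+1%:Z) - psi (n - i%:Z) - psi (n - i.+2%:Z))
  D E4 qw' (fun=> erefl).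
have e0 : n + 0%:Z = n by exact: addr0.
have e1 : n - 0%:Z = n by exact: subr0.
rewrite /= !e0 ?e1.
under eq_bigr do rewrite -fl//.
move=> hl.
under eq_bigr do rewrite -fr//.
move=> hr; move: hl hr.
under [X in _ <= _ + 3 * X + _]eq_bigr do rewrite mulrDr.
rewrite big_split /sq /=.
set Sl := \sum_(i < D) _ * f (n - _) ^+ 2; set Sr := \sum_(i < D) _ * f (n + _) ^+ 2.
set a := psi _ - _ * _; set b := psi _ - _ * _.
move=> hl hr.
have -> : c ^+ 2 * psi n ^+ 2 = (c * psi n) ^+ 2 by rewrite exprMn.
apply: (@le_trans _ _ ((secular E q q' * psi n) ^+ 2)).
  rewrite !exprMn; apply: ler_wpM2r; first exact: sqr_ge0.
  by rewrite -[leRHS]real_normK ?num_real// ler_sqr ?nnegrE.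
have -> : secular E q q' * psi n = f n + a + b.
  by rewrite fn /secular /a /b; ring.
have := sqr_ge0 (f n - a); have := sqr_ge0 (f n - b); have := sqr_ge0 (a - b).
have := sqr_ge0 (f n + a + b); move: hl hr.
move: (4^-1 ^+ D) => r; move: (psi _) => p1; move: (psi _) => p2.
move: (psi _) => p3; move: (psi _) => p4; move: (f n) => z.
move=> *; nra.
Qed.

End HalfLine.

(** * Lower bounds away from resonances *)

Section SparseWells.
Context {R : realType}.
Variables (W : int -> R) (env : set (nat -> R)).
Implicit Types (E M : R) (psi : int -> R) (n : int) (D N : nat).

Definition envr n D : nat -> R := fun i => if (i < D)%N then W (n + i.+1%:Z) else 0.
Definition envl n D : nat -> R := fun i => if (i < D)%N then W (n - i.+1%:Z) else 0.

Hypothesis W_val : forall n, W n = 4 \/ -1 <= W n <= 0.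
Hypothesis W_left : forall n, n <= 0 -> W n = 0.
Hypothesis env_well : forall q, env q -> wellpot q.
Hypothesis W_iso : forall D, exists N, forall n, N%:Z <= n -> W n = 4 ->
  env (envr n D) /\ env (envl n D).

Lemma W_bound E n : 4 <= E <= 5 -> `|E - W n| <= 6.
Proof. by move=> hE; rewrite ler_norml; case: (W_val n) => h; lra. Qed.

Lemma bnd_delta (a : R) n0 : 0 <= a -> bnd (fun n => a * (n == n0)%:R) a.
Proof.
move=> a0 x k; rewrite /win.
have [[i xi]|no] := pselect (exists i : 'I_k, x + i%:Z = n0).
  rewrite (bigD1 i)//= xi eqxx mulr1 big1 ?addr0// => j ji.
  suff /negbTE -> : x + j%:Z != n0 by rewrite mulr0.
  by apply: contra ji; rewrite -xi => /eqP /addrI [] /val_inj ->.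
rewrite big1// => i _; suff /negbTE -> : x + i%:Z != n0 by rewrite mulr0.
by apply/eqP => xi; apply: no; exists i.
Qed.

Lemma bnd_head psi N :
  bnd (fun n => \sum_(j < N) sq psi j%:Z * (n == j%:Z)%:R) (\sum_(j < N) sq psi j%:Z).
Proof. by apply: bnd_sum => j; apply: bnd_delta; exact: sq_ge0. Qed.

Lemma tail_estimate E c : 4 <= E <= 5 -> 0 < c ->
  (forall q q', env q -> env q' -> c <= `|secular E q q'|) ->
  exists N, exists2 a, 0 <= a & forall psi M M', bnd (sq psi) M ->
    bnd (sq (jac E W psi)) M' ->
    bnd (sq psi) (a * M' + 2 * \sum_(j < N) sq psi j%:Z).
Proof.
move=> hE c0 gap; have E4 : 4 <= E by case/andP: hE.
have c20 : 0 < c ^+ 2 by rewrite exprn_gt0.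
have [D hD] : exists D, 4^-1 ^+ D <= c ^+ 2 / 192.
  have cv : (fun n : nat => (4^-1 : R) ^+ n) @ \oo --> (0 : R).
    by apply: cvg_expr; rewrite ger0_norm; lra.
  have c2 : 0 < c ^+ 2 / 192 by rewrite divr_gt0//; lra.
  have [D _ hD] := cvgr_lt _ cv _ c2.
  by exists D; apply/ltW/hD => /=.
have [N0 iso] := W_iso D; set N := N0.+1.
pose ci := (c ^+ 2)^-1.
have ci0 : 0 < ci by rewrite invr_gt0.
have cic : ci * c ^+ 2 = 1 by rewrite mulVf// gt_eqF.
exists N0, (2 * (3 / 16 + 5 * ci)); first by rewrite mulr_ge0// addr_ge0 ?mulr_ge0//; lra.
move=> psi M0 M' psiM fM; set f := jac E W psi in fM.
set H := \sum_(j < N0) _.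
have -> : 2 * (3 / 16 + 5 * ci) * M' + 2 * H = 2 * ((3 / 16 + 5 * ci) * M' + H) by ring.
apply: (bnd_ind _ _ (sq_ge0 psi) _ _ psiM) => M pM.
pose site n := 3 * sq f n
    + 3 * \sum_(i < D) 4^-1 ^+ i.+1 * (sq f (n + i.+1%:Z) + sq f (n - i.+1%:Z))
    + 6 * 4^-1 ^+ D * (sq psi (n + D.+1%:Z) + sq psi (n + D%:Z)
                       + (sq psi (n - D.+1%:Z) + sq psi (n - D%:Z))).
pose far n := 3 / 16 * (sq f n + (sq psi (n - 1) + sq psi (n + 1))).
pose head n := \sum_(j < N0) sq psi j%:Z * (n == j%:Z)%:R.
have r0 k : 0 <= 4^-1 ^+ k :> R by apply: exprn_ge0; lra.
have site0 n : 0 <= site n.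
  have s1 k : 0 <= sq f k := sq_ge0 f k; have s2 k : 0 <= sq psi k := sq_ge0 psi k.
  apply: addr_ge0; first apply: addr_ge0.
  - by apply: mulr_ge0.
  - apply: mulr_ge0 => //; apply: sumr_ge0 => i _; apply: mulr_ge0 => //.
    exact: addr_ge0.
  - by apply: mulr_ge0; [apply: mulr_ge0 | apply: addr_ge0; apply: addr_ge0].
have far0 n : 0 <= far n.
  apply: mulr_ge0; first by lra.
  by apply: addr_ge0; [|apply: addr_ge0]; exact: sq_ge0.
have head0 n : 0 <= head n.
  by rewrite sumr_ge0// => j _; rewrite mulr_ge0 ?sq_ge0.
have point n : sq psi n <= far n + ci * site n + head n.
  have cs0 : 0 <= ci * site n by rewrite mulr_ge0// ltW.
  have [Wn|Wn] := W_val n; last first.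
    suff : sq psi n <= far n by have := head0 n; lra.
    have : f n = (E - W n) * psi n - psi (n - 1) - psi (n + 1) by [].
    rewrite /far /sq; move: (f n) (psi n) (psi (n - 1)) (psi (n + 1)) => y a b d e.
    have : (E - W n) * a = y + b + d by lra.
    have z4 : 4 <= E - W n by lra.
    move: (E - W n) z4 => z z4 ee.
    have h16 : 16 * a ^+ 2 <= (y + b + d) ^+ 2.
      by rewrite -ee exprMn; apply: ler_wpM2r; [exact: sqr_ge0|nra].
    have := sqr_ge0 (y - b); have := sqr_ge0 (y - d); have := sqr_ge0 (b - d); lra.
  have [nN|nN] := leP N0%:Z n.
    have [er el] := iso n nN Wn.
    suff : sq psi n <= ci * site n by have := head0 n; have := far0 n; lra.
    rewrite -[leLHS]mul1r -cic -mulrA; apply: ler_wpM2l; first exact: ltW.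
    apply: (well_site E (envr n D) (envl n D)) => //.
    - exact: env_well.
    - exact: env_well.
    - exact: ltW.
    - exact: gap.
    - by rewrite /f /jac Wn.
    - move=> i iD; rewrite /f /jac /envr iD; congr (_ - psi _ - psi _); lia.
    - move=> i iD; rewrite /f /jac /envl iD.
      rewrite -addrA [- psi _ - _]addrC addrA; congr (_ - psi _ - psi _); lia.
  have n0 : 0 < n.
    rewrite ltNge; apply/negP => /W_left; rewrite Wn => e; lra.
  suff : sq psi n <= head n by have := far0 n; lra.
  have [k ek] : exists k : nat, n = k%:Z by exists (absz n); lia.
  have kN : (k < N0)%N by lia.
  rewrite /head (bigD1 (Ordinal kN))//= ek eqxx mulr1 lerDl sumr_ge0//.
  by move=> j _; rewrite mulr_ge0 ?sq_ge0.
have siteB : bnd site (3 * M' + 3 * \sum_(i < D) 4^-1 ^+ i.+1 * (M' + M')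
    + 6 * 4^-1 ^+ D * (M + M + (M + M))).
  apply: bndD; [apply: bndD|].
  - by apply: bndZ.
  - apply: bndZ => //; apply: bnd_sum => i; apply: bndZ => //.
    by apply: bndD; exact: bnd_shift.
  - apply: bndZ; first by rewrite mulr_ge0.
    by apply: bndD; apply: bndD; exact: bnd_shift.
have farB : bnd far (3 / 16 * (M' + (M + M))).
  apply: bndZ; first by lra.
  by apply: bndD => //; apply: bndD; exact: bnd_shift.
have B := bndD _ _ _ _ (bndD _ _ _ _ farB (bndZ _ _ _ (ltW ci0) siteB)) (bnd_head psi N0).
apply: bnd_weaken (bnd_le _ _ _ point B).
rewrite -/H -mulr_suml.
have M0' := bnd_ge0 _ _ fM; have M00 := bnd_ge0 _ _ pM.
have g := geom_sum_le (R := R) D.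
have h1 : (\sum_(i < D) 4^-1 ^+ i.+1) * (M' + M') <= 3^-1 * (M' + M').
  by apply: ler_wpM2r => //; lra.
have h2 : 4^-1 ^+ D * M <= c ^+ 2 / 192 * M by apply: ler_wpM2r.
have h3 : 3 * M' + 3 * ((\sum_(i < D) 4^-1 ^+ i.+1) * (M' + M'))
    + 6 * 4^-1 ^+ D * (M + M + (M + M)) <= 5 * M' + c ^+ 2 * M / 8 by lra.
have := ler_wpM2l (ltW ci0) h3.
have -> : ci * (5 * M' + c ^+ 2 * M / 8) = 5 * ci * M' + (ci * c ^+ 2) * M / 8 by ring.
rewrite cic; lra.
Qed.

Definition m0 E : R := cf E (fun=> 0).

Lemma wellpot0 : wellpot (fun=> 0 : R).
Proof. by move=> i; lra. Qed.

Lemma m0_eq E : 4 <= E -> m0 E * (E - m0 E) = 1.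
Proof. by move=> E4; have := cf_eq E _ E4 wellpot0; rewrite subr0. Qed.

Fixpoint upair E k : R * R :=
  if k is k'.+1 then
    let: (a, b) := upair E k' in (b, (E - W k'.+1%:Z) * b - a)
  else (m0 E, 1).

(* The solution of jac E W u = 0 which decays at minus infinity. *)
Definition usol E n : R :=
  match n with Posz k => (upair E k).1 | Negz k => m0 E ^+ k.+2 end.

Lemma usol_jac E n : 4 <= E -> jac E W (usol E) n = 0.
Proof.
move=> E4; have e := m0_eq E E4; rewrite /jac.
case: n => [[|k]|[|k]].
- rewrite W_left// subr0.
  have -> : usol E 0%:Z = m0 E by [].
  have -> : usol E (0%:Z - 1) = m0 E ^+ 2 by [].
  have -> : usol E (0%:Z + 1) = 1 by [].
  by rewrite -e expr2; ring.
- have -> : k.+1%:Z - 1 = k%:Z by lia.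
  have -> : k.+1%:Z + 1 = k.+2%:Z by lia.
  by rewrite /usol /=; case: (upair E k) => a b /=; ring.
- rewrite W_left// subr0.
  have -> : usol E (Negz 0 - 1) = m0 E ^+ 3 by [].
  have -> : usol E (Negz 0 + 1) = m0 E by [].
  have -> : usol E (Negz 0) = m0 E ^+ 2 by [].
  transitivity (m0 E * (m0 E * (E - m0 E)) - m0 E); first by ring.
  by rewrite e mulr1 subrr.
- rewrite W_left// subr0.
  have -> : Negz k.+1 - 1 = Negz k.+2 by lia.
  have -> : Negz k.+1 + 1 = Negz k by lia.
  rewrite /usol; transitivity (m0 E ^+ k.+2 * (m0 E * (E - m0 E)) - m0 E ^+ k.+2).
    by rewrite !exprS; ring.
  by rewrite e mulr1 subrr.
Qed.

Definition right_l2 E := exists M, forall N : nat, \sum_(j < N) sq (usol E) j%:Z <= M.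

Lemma left_boundary E psi M M' : 4 <= E -> bnd (sq psi) M ->
  bnd (sq (jac E W psi)) M' -> (psi 0 - m0 E * psi 1) ^+ 2 <= M'.
Proof.
move=> E4 pM fM; apply: (@le_geometric_limit _ 4^-1 _ _ (4 * M)); first by lra.
move=> D.
have e i : jac E W psi (- i%:Z) =
    (E - 0) * psi (1 - i.+1%:Z) - psi (1 - i%:Z) - psi (1 - i.+2%:Z).
  rewrite /jac W_left; last by lia.
  rewrite -addrA [- psi _ - _]addrC addrA; congr (_ * psi _ - psi _ - psi _); lia.
have := half_line E (fun=> 0) (fun i => psi (1 - i%:Z)) _ D E4 wellpot0 e.
rewrite /= !subr0 subrr -/(m0 E) => /le_trans; apply.
have p n := bnd_point _ _ n pM; have f n := bnd_point _ _ n fM.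
have r0 k : 0 <= 4^-1 ^+ k :> R by apply: exprn_ge0; lra.
apply: lerD.
  apply: (@le_trans _ _ (\sum_(i < D) 4^-1 ^+ i.+1 * M')).
    by apply: ler_sum => i _; apply: ler_wpM2l => //; exact: f.
  have := geom_sum_le (R := R) D; rewrite -mulr_suml; have := bnd_ge0 _ _ fM.
  by move: (\sum_(i < D) _) => z; nra.
rewrite [leRHS]mulrC; apply: ler_wpM2l => //.
have := p (1 - D.+1%:Z); have := p (1 - D%:Z); rewrite /sq; lra.
Qed.

Lemma growth E k : 4 <= E <= 5 -> exists2 C, 0 <= C &
  forall psi M M', bnd (sq psi) M -> bnd (sq (jac E W psi)) M' ->
   (psi k%:Z - psi 1 * usol E k%:Z) ^+ 2 <= C * M'.
Proof.
move=> hE; have E4 : 4 <= E by case/andP: hE.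
suff : (exists2 C, 0 <= C &
  forall psi M M', bnd (sq psi) M -> bnd (sq (jac E W psi)) M' ->
   (psi k%:Z - psi 1 * usol E k%:Z) ^+ 2 <= C * M') /\
  (exists2 C, 0 <= C &
  forall psi M M', bnd (sq psi) M -> bnd (sq (jac E W psi)) M' ->
   (psi k.+1%:Z - psi 1 * usol E k.+1%:Z) ^+ 2 <= C * M') by case.
elim: k => [|k [[C1 C10 h1] [C2 C20 h2]]].
  split.
    exists 1 => // psi M M' pM fM; rewrite mul1r [_ * usol _ _]mulrC.
    exact: left_boundary pM fM.
  exists 0 => // psi M M' pM fM.
  by rewrite [usol _ _]/= mulr1 subrr expr0n mul0r.
split; first by exists C2.
exists (3 * (36 * C2 + C1 + 1)); first by lra.
move=> psi M M' pM fM; have := h1 _ _ _ pM fM; have := h2 _ _ _ pM fM.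
have := bnd_point _ _ k.+1%:Z fM; rewrite {1}/sq.
have := usol_jac E k.+1%:Z E4; rewrite /jac.
have -> : k.+1%:Z - 1 = k%:Z by lia.
have -> : k.+1%:Z + 1 = k.+2%:Z by lia.
have := W_bound E k.+1%:Z hE.
move: (E - W _) (usol E k%:Z) (usol E k.+1%:Z) (usol E k.+2%:Z) => z u0 u1 u2.
move: (psi k%:Z) (psi k.+1%:Z) (psi k.+2%:Z) (psi 1) => x0 x1 x2 c.
rewrite ler_norml => hz hu.
have z2 : z ^+ 2 <= 36 by nra.
have -> : x2 - c * u2 = z * (x1 - c * u1) - (x0 - c * u0) - (z * x1 - x0 - x2).
  by rewrite (_ : u2 = z * u1 - u0); [ring|lra].
move: (x1 - _) (x0 - _) (_ - x2) => a b y hy ha hb.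
have : (z * a) ^+ 2 <= 36 * a ^+ 2 by rewrite exprMn; apply: ler_wpM2r => //; exact: sqr_ge0.
move: (z * a) => w hw.
have := sqr_ge0 (w + b); have := sqr_ge0 (w + y); have := sqr_ge0 (b - y); nra.
Qed.

Lemma bounded_below_of_gap E c : 4 <= E <= 5 -> 0 < c ->
  (forall q q', env q -> env q' -> c <= `|secular E q q'|) ->
  ~ right_l2 E -> exists2 kappa, 1 <= kappa & bounded_below E W kappa.
Proof.
move=> hE c0 gap nr.
have [N [a a0 tail]] := tail_estimate E c hE c0 gap.
have /choice [C hC] k : exists C, 0 <= C /\
  forall psi M M', bnd (sq psi) M -> bnd (sq (jac E W psi)) M' ->
   (psi k%:Z - psi 1 * usol E k%:Z) ^+ 2 <= C * M'.
  by have [C ? ?] := growth E k hE; exists C.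
pose b := 4 * \sum_(j < N) sq (usol E) j%:Z.
pose a1 := a + 4 * \sum_(j < N) C j.
have b0 : 0 <= b by rewrite mulr_ge0// sumr_ge0// => j _; exact: sq_ge0.
have a10 : 0 <= a1.
  by rewrite addr_ge0// mulr_ge0// sumr_ge0// => j _; case: (hC j).
have h1 psi M M' : bnd (sq psi) M -> bnd (sq (jac E W psi)) M' ->
    bnd (sq psi) (a1 * M' + b * psi 1 ^+ 2).
  move=> pM fM; apply: bnd_weaken (tail _ _ _ pM fM).
  suff : \sum_(j < N) sq psi j%:Z <=
     2 * (\sum_(j < N) C j) * M' + 2 * (\sum_(j < N) sq (usol E) j%:Z) * psi 1 ^+ 2.
    by rewrite /a1 /b; lra.
  rewrite -!mulrA !mulr_suml !mulr_sumr -big_split; apply: ler_sum => j _ /=.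
  have [_ /(_ _ _ _ pM fM)] := hC j; rewrite /sq.
  move: (psi j) (usol E j) (psi 1) => x u y h.
  have := sqr_ge0 (x - y * u - y * u); nra.
have [N1 hN1] : exists N1 : nat, 2 * b + 1 <= \sum_(j < N1) sq (usol E) j%:Z.
  apply: contrapT => no; apply: nr; exists (2 * b + 1) => N1.
  by rewrite leNgt; apply/negP => lt; apply: no; exists N1; exact: ltW.
pose a2 := 2 * a1 + 2 * \sum_(j < N1) C j.
have a20 : 0 <= a2.
  by rewrite addr_ge0// mulr_ge0// sumr_ge0// => j _; case: (hC j).
exists (a1 + b * a2 + 1); first by rewrite lerDr addr_ge0// mulr_ge0.
move=> psi M M' pM fM; have B := h1 _ _ _ pM fM.
have M'0 := bnd_ge0 _ _ fM.
suff h2 : psi 1 ^+ 2 <= a2 * M'.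
  apply: bnd_weaken B; have := ler_wpM2l b0 h2; lra.
have s : psi 1 ^+ 2 * \sum_(j < N1) sq (usol E) j%:Z <=
   2 * \sum_(j < N1) sq psi j%:Z + 2 * (\sum_(j < N1) C j) * M'.
  rewrite -mulrA mulr_suml !mulr_sumr -big_split; apply: ler_sum => j _ /=.
  have [_ /(_ _ _ _ pM fM)] := hC j; rewrite /sq.
  move: (psi j) (usol E j) (psi 1) => x u y h.
  have := sqr_ge0 (x + (x - y * u)); nra.
have w : \sum_(j < N1) sq psi j%:Z <= a1 * M' + b * psi 1 ^+ 2.
  have := B 0 N1; rewrite /win; under eq_bigr do rewrite add0r.
  by [].
have := ler_wpM2l (sqr_ge0 (psi 1)) hN1; rewrite /a2; lra.
Qed.

Lemma right_l2_bnd E : 4 <= E -> right_l2 E -> exists M, bnd (sq (usol E)) M.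
Proof.
move=> E4 [M hM]; exists (1 + M) => x k.
have [K xK] : exists K : nat, win (sq (usol E)) x k <= box (sq (usol E)) K.
  have := near_win_box _ x k (sq_ge0 (usol E)).
  by move=> [K _ /(_ K (leqnn K))]; exists K.
apply: le_trans xK _; rewrite /box winD.
apply: lerD; last first.
  rewrite /win; under eq_bigr do rewrite addNr add0r.
  exact: hM.
pose m := m0 E ^+ 2.
have hm : 0 <= m <= 9^-1.
  by have := cf_bounds E _ E4 wellpot0; rewrite -/(m0 E) /m => h; apply/andP; split; nra.
have sqN j : sq (usol E) (- j.+1%:Z) = m ^+ j.+2.
  have -> : - j.+1%:Z = Negz j by lia.
  by rewrite /sq /= exprAC.
have m0n j : 0 <= m ^+ j by apply: exprn_ge0; lra.
suff : win (sq (usol E)) (- K%:Z) K <= 1 - m ^+ K.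
  by have := m0n K; lra.
elim: K => [|K IH]; first by rewrite /win big_ord0 expr0 subrr.
rewrite -[K.+1 in X in X <= _]add1n winD win1 sqN.
have -> : - K.+1%:Z + 1%:Z = - K%:Z by lia.
have := m0n K; move: IH; rewrite !exprS; move: (m ^+ K) (win _ _ _) => y w hw y0.
have m2 : 0 <= 1 - m - m * m by nra.
have := mulr_ge0 y0 m2; lra.
Qed.

End SparseWells.

(** * Eigenvalues and approximate eigenvectors *)

Section CountableEigenvalues.
Context {R : realType}.
Variables (W : int -> R) (u : R -> int -> R) (A : set R).
Hypothesis u_jac : forall E n, A E -> jac E W (u E) n = 0.
Hypothesis u1 : forall E, u E 1 = 1.
Implicit Types (E M : R) (s : seq R).

Lemma near_orthogonal E E' M e : A E -> A E' -> E != E' ->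
  bnd (sq (u E)) M -> bnd (sq (u E')) M -> 0 < e ->
  \forall K \near \oo, `|box (fun n => u E n * u E' n) K| <= e.
Proof.
move=> AE AE' EE' h h' e0.
have d0 : 0 < `|E - E'| by rewrite normr_gt0 subr_eq0.
have := wronskian_small _ _ _ _ _ h h' (mulr_gt0 d0 e0).
apply: filterS => K.
have := win_green E E' W (u E) (u E') (- K%:Z) (K + K).
rewrite {1}/win big1 => [|i _]; last by rewrite !u_jac// !mul0r subrr.
rewrite -/(box _ _) => g.
have -> : wronskian (u E) (u E') (- K%:Z + (K + K)%N%:Z - 1)
    - wronskian (u E) (u E') (- K%:Z - 1)
  = - ((E - E') * box (fun n => u E n * u E' n) K) by lra.
by rewrite normrN normrM ler_pM2l.
Qed.

Definition usum s n := \sum_(E <- s) u E n.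

(* A Bessel inequality: the cross terms vanish in the limit. *)
Lemma near_usum s M : uniq s -> (forall E, E \in s -> A E /\ bnd (sq (u E)) M) ->
  forall e, 0 < e -> \forall K \near \oo, box (sq (usum s)) K <= (size s)%:R * M + e.
Proof.
elim: s => [|E s IH] /=.
  move=> _ _ e e0; near=> K.
  rewrite mul0r add0r /box /win big1 ?ltW// => i _.
  by rewrite /sq /usum big_nil expr0n.
move=> /andP[Es us] hs e e0.
have [AE EM] := hs E (mem_head _ _).
have hs' E' : E' \in s -> A E' /\ bnd (sq (u E')) M by move=> h; apply: hs; rewrite inE h orbT.
have e2 : 0 < e / 2 by lra.
have cross : forall d, 0 < d -> \forall K \near \oo, `|box (fun n => u E n * usum s n) K| <= d.
  move: Es hs'; elim: (s) => [|E' t IHt] Es hs' d d0.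
    near=> K; rewrite /box /win big1 ?normr0 ?ltW// => i _.
    by rewrite /usum big_nil mulr0.
  have d2 : 0 < d / 2 by lra.
  have [AE' EM'] := hs' E' (mem_head _ _).
  move: Es; rewrite inE negb_or => /andP[EE' Et].
  have h1 := near_orthogonal _ _ _ _ AE AE' EE' EM EM' d2.
  have h2 := IHt Et (fun x hx => hs' x (mem_behead (s := E' :: t) hx)) _ d2.
  near=> K.
  have -> : box (fun n => u E n * usum (E' :: t) n) K =
     box (fun n => u E n * u E' n) K + box (fun n => u E n * usum t n) K.
    rewrite /box /win -big_split; apply: eq_bigr => i _.
    by rewrite /usum big_cons mulrDr.
  apply: le_trans (ler_normD _ _) _.
  have : `|box (fun n => u E n * u E' n) K| <= d / 2 by near: K; exact: h1.
  have : `|box (fun n => u E n * usum t n) K| <= d / 2 by near: K; exact: h2.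
  lra.
have e4 : 0 < e / 4 by lra.
have h1 := cross _ e4; have h2 := IH us hs' _ e2.
near=> K.
have -> : box (sq (usum (E :: s))) K = box (sq (u E)) K + box (sq (usum s)) K
   + 2 * box (fun n => u E n * usum s n) K.
  rewrite /box /win mulr_sumr -!big_split; apply: eq_bigr => i _ /=.
  by rewrite /sq /usum big_cons; ring.
have b1 : box (sq (u E)) K <= M by exact: EM.
have b2 : box (sq (usum s)) K <= (size s)%:R * M + e / 2 by near: K; exact: h2.
have : `|box (fun n => u E n * usum s n) K| <= e / 4 by near: K; exact: h1.
rewrite ler_norml => /andP[_ c1]; rewrite [size _]/= -[(size s).+1%:R]natr1; lra.
Unshelve. all: by end_near. Qed.

Lemma size_bounded_eigenvalues s M : 0 <= M -> uniq s ->
  (forall E, E \in s -> A E /\ bnd (sq (u E)) M) -> (size s)%:R <= M + 1.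
Proof.
move=> M0 us hs; have h1 := near_usum _ _ us hs _ ltr01.
have h2 := near_win_box _ 1 1 (sq_ge0 (usum s)).
near \oo => K.
have b1 : box (sq (usum s)) K <= (size s)%:R * M + 1 by near: K; exact: h1.
have : win (sq (usum s)) 1 1 <= box (sq (usum s)) K by near: K; exact: h2.
rewrite win1 /sq /usum; under eq_bigr do rewrite u1.
rewrite big_const_seq count_predT iter_addr addr0.
rewrite leNgt => b2; apply/negP => lt.
have n1 : 1 <= (size s)%:R :> R by lra.
nra.
Unshelve. all: by end_near. Qed.

Lemma countable_eigenvalues : countable [set E | A E /\ exists M, bnd (sq (u E)) M].
Proof.
have -> : [set E | A E /\ exists M, bnd (sq (u E)) M] =
   \bigcup_(i in [set: nat]) [set E | A E /\ bnd (sq (u E)) i%:R].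
  apply/seteqP; split=> [E [AE [M hM]]|E [i _ [AE h]]]; last by split=> //; exists i%:R.
  exists (Num.truncn M).+1 => //; split=> //.
  by apply: bnd_weaken hM; rewrite ltW// truncnS_gt.
apply: bigcup_countable => // i _; apply: finite_set_countable.
apply: contrapT => /(@infinite_set_fset _ _ i.+2) [B BA Bi].
have : (size (finmap.enum_fset B))%:R <= i%:R + 1 :> R.
  by apply: size_bounded_eigenvalues => //; exact: finmap.fset_uniq.
by rewrite natr1 ler_nat leqNgt Bi.
Qed.

End CountableEigenvalues.

Section ApproximateEigenvector.
Context {R : realType}.
Implicit Types (E : R) (q : nat -> R).

Fixpoint decay E q k : R :=
  if k is k'.+1 then decay E q k' * cf E (qshift k' q) else 1.

Lemma decay_rec E q k : 4 <= E -> wellpot q ->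
  (E - q k) * decay E q k.+1 = decay E q k + decay E q k.+2.
Proof.
move=> E4 qw.
have := cf_eq E _ E4 (wellpot_qshift k _ qw).
have -> : qshift 1 (qshift k q) = qshift k.+1 q.
  by apply/funext => i; rewrite /qshift addnA addn1.
rewrite {2}/qshift addn0 /= => e.
move: e; move: (cf E _) (cf E _) (decay _ _ _) => a b x e.
by rewrite -{2}[x]mulr1 -e; ring.
Qed.

Lemma decay_bounds E q k : 4 <= E -> wellpot q -> 0 <= decay E q k <= 3^-1 ^+ k.
Proof.
move=> E4 qw; elim: k => [|k /andP[IH1 IH2]] /=; first by rewrite expr0; lra.
have := cf_bounds E _ E4 (wellpot_qshift k _ qw) => /andP[c0 c3].
by rewrite mulr_ge0//= exprSr ler_pM.
Qed.

Definition trunc_decay E q L k : R := if (k <= L)%N then decay E q k else 0.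

Lemma trunc_decay_rec E q L k w : 4 <= E -> wellpot q ->
  ((k < L)%N -> w = q k) ->
  ((E - w) * trunc_decay E q L k.+1 - trunc_decay E q L k - trunc_decay E q L k.+2) ^+ 2
  <= 9^-1 ^+ L * ((k.+1 == L)%:R + (k == L)%:R).
Proof.
move=> E4 qw hw; rewrite /trunc_decay.
have p3 : 0 <= 3^-1 ^+ L :> R by apply: exprn_ge0; lra.
have e9 : 9^-1 ^+ L = (3^-1 ^+ L) ^+ 2 :> R by rewrite -exprM mulnC exprM; congr (_ ^+ _); field.
have [kL|kL|kL] := ltngtP k L.
- rewrite (hw kL).
  case: (ltngtP k.+1 L) kL => // k1L _.
  + rewrite decay_rec// [X in X ^+ 2](_ : _ = 0); last by ring.
    by rewrite expr0n addr0 mulr0.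
  + rewrite decay_rec// [X in X ^+ 2](_ : _ = decay E q k.+2); last by ring.
    rewrite addr0 mulr1 e9.
    have /andP[d0 d1] := decay_bounds E q k.+2 E4 qw.
    rewrite ler_sqr ?nnegrE//; apply: le_trans d1 _.
    by rewrite -k1L [leLHS]exprS ler_piMl ?exprn_ge0//; lra.
- have -> : (k.+2 <= L)%N = false by apply/negbTE; lia.
  have -> : (k.+1 == L) = false by apply/negbTE; lia.
  by rewrite mulr0 !subr0 expr0n addr0 mulr0.
- subst L. have -> : (k.+2 <= k)%N = false by apply/negbTE; lia.
  have -> : (k.+1 == k) = false by apply/negbTE; lia.
  rewrite mulr0 subr0 sub0r sqrrN add0r mulr1 e9.
  have /andP[d0 d1] := decay_bounds E q k E4 qw.
  by rewrite ler_sqr ?nnegrE.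
Qed.

Lemma not_bounded_below (W : int -> R) E q q' : 4 <= E <= 5 -> wellpot q -> wellpot q' ->
  secular E q q' = 0 ->
  (forall L : nat, exists2 p : int, W p = 4 & forall i, (i < L)%N ->
     W (p + i.+1%:Z) = q i /\ W (p - i.+1%:Z) = q' i) ->
  forall kappa : R, 0 <= kappa -> ~ bounded_below E W kappa.
Proof.
move=> hE qw qw' sec rec kappa k0 below; have E4 : 4 <= E by case/andP: hE.
suff : 1 <= 0 :> R by lra.
apply: (@le_geometric_limit _ 9^-1 _ _ (kappa * (4 * 9^-1))); first by lra.
move=> L0; set L := L0.+1.
have -> : kappa * (4 * 9^-1) * 9^-1 ^+ L0 = kappa * (4 * 9^-1 ^+ L) by rewrite exprS; ring.
rewrite add0r.
have [p Wp hp] := rec L.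
pose chi d := match d with Posz k => trunc_decay E q L k | Negz k => trunc_decay E q' L k.+1 end.
pose psi n := chi (n - p).
have t0 q0 : trunc_decay E q0 L 0 = 1 by [].
have chi1 d : 0 <= chi d <= 1.
  suff t q0 k : wellpot q0 -> 0 <= trunc_decay E q0 L k <= 1 by case: d => k /=; exact: t.
  move=> q0w; rewrite /trunc_decay; case: ifP => _; last by lra.
  have /andP[-> /le_trans->//] := decay_bounds E q0 k E4 q0w.
  by apply: exprn_ile1; lra.
have chi0 d : (L < `|d|)%N -> chi d = 0.
  by case: d => k h; rewrite /chi /trunc_decay ifN// -ltnNge.
have a0 : 0 <= 9^-1 ^+ L :> R by apply: exprn_ge0; lra.
have psiM : bnd (sq psi) (\sum_(j < (L + L).+1) 1).
  apply: (@bnd_le _ _ (fun n => \sum_(j < (L + L).+1) 1 * (n == p - L%:Z + j%:Z)%:R)); last first.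
    by apply: bnd_sum => j; exact: bnd_delta.
  move=> n; have s0 (P : pred 'I_(L + L).+1) :
     0 <= \sum_(j < (L + L).+1 | P j) 1 * (n == p - L%:Z + j%:Z)%:R :> R.
    by apply: sumr_ge0 => j _; rewrite mul1r.
  rewrite /sq /psi; have [nL|nL] := ltnP L (absz (n - p)%R); first by rewrite chi0// expr0n.
  have jL : (absz (n - p + L%:Z)%R < (L + L).+1)%N by lia.
  rewrite (bigD1 (Ordinal jL))//=.
  have -> : n == p - L%:Z + (absz (n - p + L%:Z)%R)%:Z by apply/eqP; lia.
  rewrite mulr1; have := s0 (fun j => j != Ordinal jL).
  have := chi1 (n - p); move: (chi _) => x hx.
  have : x ^+ 2 <= 1 by apply: exprn_ile1; lra.
  lra.
have jacM : bnd (sq (jac E W psi)) (4 * 9^-1 ^+ L).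
  set a := 9^-1 ^+ L; have -> : 4 * a = (a + a) + (a + a) by ring.
  apply: (@bnd_le _ _ (fun n => (a * (n == p + L%:Z)%:R + a * (n == p + L.+1%:Z)%:R)
     + (a * (n == p - L%:Z)%:R + a * (n == p - L.+1%:Z)%:R))); last first.
    by apply: bndD; apply: bndD; exact: bnd_delta.
  move=> n; rewrite /sq /jac /psi.
  have [d dE] : exists d, n = p + d by exists (n - p); rewrite subrKC.
  have -> : n - p = d by lia.
  have -> : n - 1 - p = d - 1 by lia.
  have -> : n + 1 - p = d + 1 by lia.
  have b0 (b : bool) : 0 <= a * b%:R by rewrite mulr_ge0.
  have b00 (b1 b2 : bool) : 0 <= a * b1%:R + a * b2%:R by rewrite addr_ge0.
  case: d dE => [[|k]|k] dE.
  - have -> : 0%:Z - 1 = Negz 0 by [].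
    have -> : 0%:Z + 1 = 1%:Z by [].
    have -> : n = p by lia.
    rewrite Wp /chi t0 /trunc_decay /= !mul1r mulr1.
    move: sec; rewrite /secular.
    have q0 q0 : qshift 0 q0 = q0 by apply/funext.
    rewrite !q0 => sec.
    have -> : E - 4 - cf E q' - cf E q = 0 by lra.
    by rewrite expr0n addr_ge0.
  - have -> : k.+1%:Z - 1 = k%:Z by lia.
    have -> : k.+1%:Z + 1 = k.+2%:Z by lia.
    apply: (@le_trans _ _ (a * ((k.+1 == L)%:R + (k == L)%:R))).
      by apply: trunc_decay_rec => // kL; rewrite dE; case: (hp k kL).
    have -> : (n == p + L%:Z) = (k.+1 == L) by lia.
    have -> : (n == p + L.+1%:Z) = (k == L) by lia.
    by rewrite mulrDr lerDl.
  have -> : Negz k - 1 = Negz k.+1 by lia.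
  have -> : chi (Negz k + 1) = trunc_decay E q' L k.
    by case: (k) => [|k'] //; have -> : Negz k'.+1 + 1 = Negz k' by lia.
  apply: (@le_trans _ _ (a * ((k.+1 == L)%:R + (k == L)%:R))).
    rewrite /chi -addrA [- trunc_decay _ _ _ k.+2 - _]addrC addrA.
    apply: trunc_decay_rec => // kL; have [_ <-] := hp k kL.
    by rewrite dE NegzE.
  have -> : (n == p - L%:Z) = (k.+1 == L) by lia.
  have -> : (n == p - L.+1%:Z) = (k == L) by lia.
  by rewrite mulrDr lerDr.
have := bnd_point _ _ p (below _ _ _ psiM jacM).
by rewrite /sq /psi subrr (_ : chi 0 = 1) ?expr1n//; exact: t0.
Qed.

End ApproximateEigenvector.

(** * The potential *)

Definition bit (j k : nat) : bool := odd (j %/ 2 ^ k).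

Lemma bit_surj (b : nat -> bool) (L B : nat) :
  exists2 j, (B <= j)%N & forall k, (k < L)%N -> bit j k = b k.
Proof.
elim: L b => [|L IH] b; first by exists B.
have [j Bj hj] := IH (fun k => b k.+1).
exists (b 0%N + j.*2)%N; first by lia.
move=> [_|k kL]; rewrite /bit.
  by rewrite expn0 divn1 oddD odd_double addbF oddb.
by rewrite expnS divnMA -(hj k kL) /bit divn2 half_bit_double.
Qed.

Lemma bit_small j k : (j <= k)%N -> bit j k = false.
Proof. by move=> jk; rewrite /bit divn_small// (leq_ltn_trans jk)// ltn_expl. Qed.

Section Potential.
Context {R : realType}.

(* The blocks grow so fast that the digits of j - 1 are exhausted long before the
   well at 4 ^ j: the left neighbourhoods of the wells are asymptotically zero. *)
Definition pot (n : int) : R :=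
  if n is Posz k.+1 then
    let j := trunc_log 4 k.+1 in
    if (k.+1 - 4 ^ j)%N is r.+1 then - (bit j r)%:R else 4
  else 0.

Lemma pot_well j : pot (4 ^ j)%N%:Z = 4.
Proof.
have : (0 < 4 ^ j)%N by rewrite expn_gt0.
rewrite /pot; case E : (4 ^ j)%N => [|k] // _.
by rewrite -E trunc_expnK// subnn.
Qed.

Lemma pot_block j r : (0 < r < 3 * 4 ^ j)%N ->
  pot (4 ^ j + r)%N%:Z = - (bit j r.-1)%:R.
Proof.
move=> /andP[r0 r3]; rewrite /pot.
have tl : trunc_log 4 (4 ^ j + r) = j.
  by apply: trunc_log_eq => //; rewrite leq_addr expnS; lia.
case E : (4 ^ j + r)%N => [|k]; first by lia.
by rewrite -E tl addKn; case: r r0 r3 tl E.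
Qed.

Lemma potP k : (0 < k)%N ->
  exists j, k = (4 ^ j)%N \/ exists2 r, k = (4 ^ j + r)%N & (0 < r < 3 * 4 ^ j)%N.
Proof.
move=> k0; have := trunc_log_bounds (p := 4) (n := k) isT k0.
set j := trunc_log 4 k => /andP[h1 h2]; exists j.
have [->|ne] := eqVneq k (4 ^ j)%N; [by left|right].
exists (k - 4 ^ j)%N; first by lia.
by move: h2; rewrite expnS; lia.
Qed.

Lemma pot_val n : pot n = 4 \/ -1 <= pot n <= 0.
Proof.
case: n => [[|k]|k]; [right; rewrite /=; lra| |right; rewrite /=; lra].
have [j [->|[r -> hr]]] := potP k.+1 isT; first by left; exact: pot_well.
right; rewrite pot_block//; case: (bit _ _) => /=; lra.
Qed.

Lemma pot_left n : n <= 0 -> pot n = 0.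
Proof. by case: n => [[|k]|k]. Qed.

Lemma pot_eq4 n : pot n = 4 -> exists j, n = (4 ^ j)%N%:Z.
Proof.
case: n => [[|k]|k] h; [by move: h; rewrite /pot; lra| |by move: h; rewrite /pot; lra].
have [j [e|[r e hr]]] := potP k.+1 isT; first by exists j; rewrite e.
move: h; rewrite [X in pot (Posz X)]e pot_block//; case: (bit _ _) => /=; lra.
Qed.

Lemma bounded_pot : bounded_fun pot.
Proof.
exists 4; split; first exact: num_real.
move=> M M4 n _ /=; rewrite ler_norml.
by case: (pot_val n) => h; lra.
Qed.

Definition penv (l : nat) (b : nat -> bool) (i : nat) : R :=
  if (l %| i.+1)%N then - (b (i.+1 %/ l).-1)%:R else 0.

Lemma penv_well l b : wellpot (penv l b).
Proof. by move=> i; rewrite /penv; case: ifP => _; [case: (b _)|] => /=; lra. Qed.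

Variable l : nat.
Hypothesis l0 : (0 < l)%N.

Lemma sieve_mul (V : int -> R) m : sieve l V (m * l%:Z) = V m.
Proof. by rewrite /sieve dvdz_mull// mulzK//; lia. Qed.

Lemma sieve_ndvd (V : int -> R) m i : ~~ (l %| i)%N ->
  sieve l V (m * l%:Z + i%:Z) = 0 /\ sieve l V (m * l%:Z - i%:Z) = 0.
Proof.
move=> li; rewrite /sieve.
have dm : (m * l%:Z)%R \in dvdz l%:Z by exact: dvdz_mull.
by rewrite !ifN// rpredDl// rpredN.
Qed.

Lemma sieve_well n : sieve l pot n = 4 -> exists j, n = (4 ^ j)%N%:Z * l%:Z.
Proof.
rewrite {1}/sieve; case: ifP => [|_]; last by lra.
move=> /dvdzP[m ->]; rewrite mulzK; last by lia.
by move=> /pot_eq4[j ->]; exists j.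
Qed.

Lemma sieve_val n : sieve l pot n = 4 \/ -1 <= sieve l pot n <= 0.
Proof. by rewrite /sieve; case: ifP => _; [exact: pot_val|right; lra]. Qed.

Lemma sieve_left n : n <= 0 -> sieve l pot n = 0.
Proof.
move=> n0; rewrite /sieve; case: ifP => // /dvdzP[m e]; apply: pot_left.
by rewrite e mulzK; [nia|lia].
Qed.

Definition envs : set (nat -> R) := range (penv l).

Lemma envs_well q : envs q -> wellpot q.
Proof. by move=> [b _ <-]; exact: penv_well. Qed.

Lemma sieve_iso D : exists N : nat, forall n, N%:Z <= n -> sieve l pot n = 4 ->
  envs (envr (sieve l pot) n D) /\ envs (envl (sieve l pot) n D).
Proof.
exists (4 ^ D.+1 * l)%N => n hn /sieve_well [j e].
have jD : (4 ^ D.+1 <= 4 ^ j)%N by move: hn; rewrite e; nia.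
case: j e jD => [|j] e jD; first by move: jD; rewrite expn0 expnS; have := expn_gt0 4 D; lia.
have D4 : (D < 4 ^ j)%N.
  have : (4 ^ D <= 4 ^ j)%N by move: jD; rewrite !expnS; lia.
  have := ltn_expl (m := 4) D isT; lia.
have E4 : (4 ^ j.+1 = 4 * 4 ^ j)%N by rewrite expnS.
split.
- exists (fun k => (k.+1 * l <= D)%N && bit j.+1 k) => //.
  apply/funext => i; rewrite /penv /envr; case: ifPn => [/dvdnP[[|k] ek]|li] //.
    rewrite ek mulnK//=.
    case: (leqP (k.+1 * l) D) => iD /=; last by rewrite oppr0.
    have -> : n + (k.+1 * l)%N%:Z = (4 ^ j.+1 + k.+1)%N%:Z * l%:Z by rewrite e; lia.
    by rewrite sieve_mul pot_block//; nia.
  by case: ifP => // _; rewrite e; case: (sieve_ndvd pot (4 ^ j.+1)%N%:Z _ li).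
exists (fun k => (k.+1 * l <= D)%N && bit j (3 * 4 ^ j - k.+1).-1) => //.
apply/funext => i; rewrite /penv /envl; case: ifPn => [/dvdnP[[|k] ek]|li] //.
  rewrite ek mulnK//=.
  case: (leqP (k.+1 * l) D) => iD /=; last by rewrite oppr0.
  have -> : n - (k.+1 * l)%N%:Z = (4 ^ j + (3 * 4 ^ j - k.+1))%N%:Z * l%:Z.
    rewrite e E4.
    have -> : (4 ^ j + (3 * 4 ^ j - k.+1) = 4 * 4 ^ j - k.+1)%N by nia.
    have k4 : (k.+1 <= 4 * 4 ^ j)%N by nia.
    by rewrite -subzn// mulrBl.
  by rewrite sieve_mul pot_block//; nia.
by case: ifP => // _; rewrite e; case: (sieve_ndvd pot (4 ^ j.+1)%N%:Z _ li).
Qed.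

Lemma sieve_recurrence b (L : nat) : exists2 p : int, sieve l pot p = 4 &
  forall i, (i < L)%N -> sieve l pot (p + i.+1%:Z) = penv l b i /\
                        sieve l pot (p - i.+1%:Z) = 0.
Proof.
have [[|j] jL hj] := bit_surj b L L.+2; first by lia.
have j4 : (j < 4 ^ j)%N by apply: ltn_expl.
have E4 : (4 ^ j.+1 = 4 * 4 ^ j)%N by rewrite expnS.
exists ((4 ^ j.+1)%N%:Z * l%:Z); first by rewrite sieve_mul pot_well.
move=> i iL; rewrite /penv; case: ifPn => [/dvdnP[[|k] ek]|li] //; last first.
  by apply: sieve_ndvd.
rewrite ek mulnK//=; have kL : (k < L)%N by nia.
split.
  rewrite -PoszM -PoszD -mulnDl PoszM sieve_mul pot_block; last by nia.
  by rewrite hj.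
have -> : (4 ^ j.+1)%N%:Z * l%:Z - (k.+1 * l)%N%:Z = (4 ^ j + (3 * 4 ^ j - k.+1))%N%:Z * l%:Z.
  have -> : (4 ^ j + (3 * 4 ^ j - k.+1) = 4 ^ j.+1 - k.+1)%N by nia.
  have k4 : (k.+1 <= 4 ^ j.+1)%N by nia.
  by rewrite -subzn// mulrBl PoszM.
rewrite sieve_mul pot_block; last by nia.
by rewrite bit_small ?oppr0//; nia.
Qed.

End Potential.

(** * Hausdorff measures *)

Section Hausdorff.
Context {R : realType}.
Implicit Types (A C U : set R) (s d delta : R).

Lemma diam_le U d : (forall x y, U x -> U y -> `|x - y| <= d) ->
  (diam U <= d%:E)%E.
Proof.
move=> h; apply: ge_ereal_sup => _ [x Ux [y Uy <-]].
by rewrite lee_fin; exact: h.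
Qed.

Lemma dist_le_diam U x y : U x -> U y -> (`|x - y|%:E <= diam U)%E.
Proof. by move=> Ux Uy; apply: ereal_sup_ubound; exists x => //; exists y. Qed.

Lemma diam_ge0 U : U !=set0 -> (0 <= diam U)%E.
Proof. by move=> [x Ux]; have := dist_le_diam _ _ _ Ux Ux; rewrite subrr normr0. Qed.

Lemma diam_pow_set0 s : diam_pow s (set0 : set R) = 0%E.
Proof. by rewrite /diam_pow; case: asboolP. Qed.

Lemma diam_powE s U : U !=set0 -> diam_pow s U = poweR (diam U) s.
Proof. by move=> /set0P/eqP U0; rewrite /diam_pow; case: asboolP. Qed.

Lemma diam_pow_ge0 s U : (0 <= diam_pow s U)%E.
Proof. by rewrite /diam_pow; case: asboolP => // _; exact: poweR_ge0. Qed.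

Lemma diam_pow_le s d U : 0 <= s -> 0 <= d -> (diam U <= d%:E)%E ->
  (diam_pow s U <= (d `^ s)%:E)%E.
Proof.
move=> s0 d0 Ud; have [->|/set0P U0] := eqVneq U set0.
  by rewrite diam_pow_set0 lee_fin powR_ge0.
rewrite diam_powE// -poweR_EFin; apply: gt0_ler_poweR => //.
  by rewrite in_itv/= diam_ge0// leey.
by rewrite in_itv/= lee_fin d0 leey.
Qed.

Lemma hausdorff_measure_ge0 s A : (0 <= hausdorff_measure s A)%E.
Proof.
apply: (@le_trans _ _ (hausdorff_premeasure s 1 A)).
  apply: le_ereal_inf_tmp => _ [U _ <-].
  by apply: nneseries_ge0 => i _ _; exact: diam_pow_ge0.
by apply: ereal_sup_ubound; exists 1 => //=; exact: ltr01.
Qed.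

Lemma partial_sum_le (f : nat -> \bar R) (N n : nat) (c : R) : 0 <= c ->
  (forall i, (i < N)%N -> (f i <= c%:E)%E) -> (forall i, (N <= i)%N -> (f i <= 0)%E) ->
  (\sum_(0 <= i < n) f i <= (N%:R * c)%:E)%E.
Proof.
move=> c0 fc f0; apply: (@le_trans _ _ ((minn n N)%:R * c)%:E).
  elim: n => [|n IH]; first by rewrite big_nil min0n mul0r.
  rewrite big_nat_recr//=; have [nN|Nn] := ltnP n N.
    rewrite (minn_idPl nN) -natr1 mulrDl mul1r EFinD.
    by apply: leeD; [rewrite (minn_idPl (ltnW nN)) in IH | exact: fc].
  rewrite (minn_idPr (leq_trans Nn (leqnSn n))) -[leRHS]adde0.
  by apply: leeD; [rewrite (minn_idPr Nn) in IH | exact: f0].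
by rewrite lee_fin ler_wpM2r// ler_nat geq_minr.
Qed.

Lemma hausdorff_null s A C : 0 < s -> countable C ->
  (forall delta e, 0 < delta -> 0 < e -> exists (T : finType) (U : T -> set R) d,
    [/\ 0 <= d <= delta, forall t, (diam (U t) <= d%:E)%E,
        A `<=` C `|` \bigcup_(t in [set: T]) U t & #|T|%:R * d `^ s <= e]) ->
  hausdorff_measure s A = 0%E.
Proof.
move=> s0 /countable_injP[f finj] cover.
apply/eqP; rewrite eq_le hausdorff_measure_ge0 andbT.
apply: ge_ereal_sup => _ [delta /= delta0 <-].
apply/lee_addgt0Pr => e e0; rewrite add0e.
have [T [U [d [/andP[d0 dd] Ud AU Te]]]] := cover _ _ delta0 e0.
pose G i : set R := if insub i is Some j then U (enum_val (j : 'I_#|T|))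
                    else [set x | C x /\ f x = (i - #|T|)%N].
have GT i (iT : (i < #|T|)%N) : G i = U (enum_val (Ordinal iT)).
  by rewrite /G insubT.
have GC i : (#|T| <= i)%N -> G i = [set x | C x /\ f x = (i - #|T|)%N].
  by move=> Ti; rewrite /G insubF// ltnNge Ti.
have GC0 i : (#|T| <= i)%N -> (diam (G i) <= 0)%E.
  move=> /GC ->; apply: diam_le => x y [Cx fx] [Cy fy].
  by rewrite (finj x y) ?inE// ?fx// subrr normr0.
apply: ge_ereal_inf; exists (\sum_(0 <= i <oo) diam_pow s (G i))%E.
  exists G => //; split.
    move=> x /AU [Cx|[t _ Ut]].
      exists (f x + #|T|)%N => //; rewrite GC ?leq_addl//=; split=> //.
      by rewrite addnK.
    exists (enum_rank t) => //; rewrite (GT _ (ltn_ord _)).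
    by rewrite (_ : Ordinal _ = enum_rank t) ?enum_rankK//; exact: val_inj.
  move=> i; have [iT|Ti] := ltnP i #|T|.
    by rewrite (GT _ iT) (le_trans (Ud _))// lee_fin.
  by rewrite (le_trans (GC0 _ Ti))// lee_fin ltW.
apply: (@le_trans _ _ (#|T|%:R * d `^ s)%:E); last by rewrite lee_fin.
apply: lime_le; first by apply: is_cvg_nneseries => i _ _; exact: diam_pow_ge0.
near=> n; apply: partial_sum_le; first exact: powR_ge0.
  by move=> i iT; apply: diam_pow_le => //; [exact: ltW|rewrite (GT _ iT)].
move=> i Ti; have := diam_pow_le s 0 (G i) (ltW s0) (lexx _) (GC0 _ Ti).
by rewrite powR0// gt_eqF.
Unshelve. all: by end_near. Qed.

(* The preimages under g of a cover of A lie in intervals covering [0, 1[, so the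
   weights add up to at least a fixed multiple of the Lebesgue measure 1. *)
Lemma hausdorff_lower s A (g : R -> R) (c : R) : 0 <= s -> 0 < c ->
  (forall x, 0 <= x < 1 -> A (g x)) ->
  (forall x y, 0 <= x < 1 -> 0 <= y < 1 -> x != y ->
    0 < `|g x - g y| /\ (`|g x - g y| <= 1 -> `|x - y| <= c * `|g x - g y| `^ s)) ->
  hausdorff_measure s A != 0%E.
Proof.
move=> s0 c0 gA hold.
suff : ((c + c)^-1%:E <= hausdorff_measure s A)%E.
  move=> h; rewrite gt_eqF// (lt_le_trans _ h)// lte_fin invr_gt0 addr_gt0//.
apply: (@le_trans _ _ (hausdorff_premeasure s 1 A)); last first.
  by apply: ereal_sup_ubound; exists 1 => //=; exact: ltr01.
apply: le_ereal_inf_tmp => _ [U [AU U1] <-].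
pose G i : set R := [set x | 0 <= x < 1 /\ U i (g x)].
have Udiam i : U i !=set0 -> diam (U i) = (fine (diam (U i)))%:E.
  move=> Ui; rewrite fineK// ge0_fin_numE ?diam_ge0//.
  exact: le_lt_trans (U1 i) (ltry _).
pose r i := c * fine (diam (U i)) `^ s.
pose x0 i := xget 0 (G i).
pose I i : set R := if `[< G i = set0 >] then set0 else `[x0 i - r i, x0 i + r i]%classic.
have r0 i : 0 <= r i by rewrite mulr_ge0 ?powR_ge0// ltW.
have mI i : measurable (I i) by rewrite /I; case: asboolP.
have GU i x : G i x -> U i !=set0 by move=> [_ h]; exists (g x).
have cov : `[0, 1[ `<=` \bigcup_i I i.
  move=> x /=; rewrite in_itv /= => x01; have [i _ Ui] := AU _ (gA _ x01).
  exists i => //; have Gx : G i x by [].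
  rewrite /I; case: asboolP => [G0|_]; first by move: Gx; rewrite G0.
  have [x01' Ui'] : G i (x0 i) by rewrite /x0; case: xgetP => // /(_ _ Gx).
  rewrite /= in_itv /=; suff : `|x - x0 i| <= r i by rewrite ler_norml; lra.
  have [->|ne] := eqVneq x (x0 i); first by rewrite subrr normr0.
  have [g0 h] := hold _ _ x01 x01' ne.
  have dU := dist_le_diam _ _ _ Ui Ui'.
  have g1 : `|g x - g (x0 i)| <= 1 by rewrite -lee_fin; exact: le_trans dU (U1 i).
  apply: le_trans (h g1) _; apply: ler_wpM2l; first exact: ltW.
  apply: ge0_ler_powR => //.
  - by rewrite nnegrE fine_ge0 ?diam_ge0//; exact: GU Gx.
  - by rewrite -lee_fin -Udiam//; exact: GU Gx.
have leI i : (lebesgue_measure (I i) <= (c + c)%:E * diam_pow s (U i))%E.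
  rewrite /I; case: asboolP => [_|/eqP/set0P[x Gx]].
    by rewrite measure0 mule_ge0 ?diam_pow_ge0// lee_fin addr_ge0// ltW.
  have Ui := GU _ _ Gx.
  rewrite diam_powE// Udiam// poweR_EFin -EFinM.
  rewrite lebesgue_measure_itv/=; case: ifP => _.
    by rewrite -EFinD lee_fin /r; lra.
  by rewrite lee_fin mulr_ge0 ?powR_ge0// addr_ge0// ltW.
have : (lebesgue_measure (`[0%R, 1%R[%classic : set R) <=
        (c + c)%:E * \sum_(0 <= i <oo) diam_pow s (U i))%E.
  apply: (@le_trans _ _ (\sum_(0 <= i <oo) lebesgue_measure (I i))%E).
    exact: measure_sigma_subadditive.
  rewrite -nneseriesZl; last by move=> i _; exact: diam_pow_ge0.
  by apply: lee_nneseries => i _ //; exact: leI.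
rewrite lebesgue_measure_itv /= lte_fin ltr01 sube0.
have cc : 0 < c + c by rewrite addr_gt0.
move=> h; rewrite -(mule1 (c + c)^-1%:E).
rewrite lee_pdivrMl//.
Qed.

End Hausdorff.

(** * The spectrum of the sieve *)

Section Sieve.
Context {R : realType}.
Variable l : nat.
Hypothesis l0 : (0 < l)%N.
Implicit Types (E c x y : R) (b : nat -> bool) (n k : nat).

Local Notation W := (sieve l (@pot R)).
Local Notation S := (`[4, 5]%classic `&` real_spectrum (schroedinger W)).

Lemma sieve_bound E (n : int) : 4 <= E <= 5 -> `|E - W n| <= 6.
Proof. by move=> hE; apply: W_bound => //; exact: sieve_val. Qed.

Lemma spectrum_dichotomy E : S E -> right_l2 W E \/
  forall c, 0 < c -> exists b b', `|secular E (penv l b) (penv l b')| < c.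
Proof.
move=> [] /=; rewrite in_itv /= => hE spE.
have [|nr] := pselect (right_l2 W E); [by left|right] => c c0.
apply: contrapT => no; apply: spE.
have [kappa k1 below] : exists2 kappa, 1 <= kappa & bounded_below E W kappa.
  apply: (bounded_below_of_gap W (envs l) _ _ _ _ E c) => //.
  - exact: sieve_val.
  - by move=> n; exact: sieve_left.
  - by move=> q; exact: envs_well.
  - by move=> D; exact: sieve_iso.
  - move=> _ _ [b _ <-] [b' _ <-]; rewrite leNgt; apply/negP => lt.
    by apply: no; exists b, b'.
exact: bounded_below_resolvent (sieve_bound E ^~ hE) _ k1 below.
Qed.

Lemma countable_right_l2 : countable [set E | 4 <= E <= 5 /\ right_l2 W E].
Proof.
have left (n : int) : n <= 0 -> W n = 0 by exact: sieve_left.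
have E4 E : 4 <= E <= 5 -> 4 <= E by case/andP.
have h1 E (n : int) : 4 <= E <= 5 -> jac E W (usol W E) n = 0.
  by move=> /E4 ?; exact: usol_jac.
have h2 E : usol W E 1 = 1 by [].
apply: sub_countable (countable_eigenvalues W (usol W) [set E | 4 <= E <= 5] h1 h2).
apply: subset_card_le => E [hE hr]; split=> //.
exact: right_l2_bnd (E4 _ hE) hr.
Qed.

Lemma penv_prefix b b' n i : (forall k, (k < n)%N -> b k = b' k) -> (i < l * n)%N ->
  penv l b i = penv l b' i :> R.
Proof.
move=> bb il; rewrite /penv; case: ifP => // /dvdnP[[|k] e] //.
by rewrite e mulnK//= bb//; nia.
Qed.

Definition cyl n (w : {ffun 'I_n -> bool * bool}) : set R :=
  [set E | 4 <= E <= 5 /\ exists b b',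
    (forall k : 'I_n, w k = (b k, b' k)) /\
    `|secular E (penv l b) (penv l b')| <= 9^-1 ^+ (l * n)].

Lemma diam_cyl n (w : {ffun 'I_n -> bool * bool}) :
  (diam (cyl n w) <= (6 * 9^-1 ^+ (l * n))%:E)%E.
Proof.
apply: diam_le => x y [hx [b [b' [wb sb]]]] [hy [c [c' [wc sc]]]].
have bc k : (k < n)%N -> b k = c k /\ b' k = c' k.
  by move=> kn; have := wb (Ordinal kn); rewrite wc /= => -[-> ->].
have p1 := cf_prefix y (penv l b) (penv l c) (l * n) hy (penv_well _ _) (penv_well _ _)
  (fun i => penv_prefix b c n i (fun k kn => (bc k kn).1)).
have p2 := cf_prefix y (penv l b') (penv l c') (l * n) hy (penv_well _ _) (penv_well _ _)
  (fun i => penv_prefix b' c' n i (fun k kn => (bc k kn).2)).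
have := secular_slope x y (penv l b) (penv l b') hx hy (penv_well _ _) (penv_well _ _).
move=> /andP[sl _].
have := ler_normB (secular x (penv l b) (penv l b')) (secular y (penv l b) (penv l b')).
have : `|secular y (penv l b) (penv l b')| <= 3 * 9^-1 ^+ (l * n).
  move: p1 p2 sc; rewrite /secular.
  move: (cf y (penv l b)) (cf y (penv l c)) (cf y (penv l b')) (cf y (penv l c')).
  move=> m1 m2 m3 m4; rewrite !ler_norml => *; apply/andP; split; lra.
have : 0 <= 9^-1 ^+ (l * n) :> R by apply: exprn_ge0; lra.
move=> h1 h2 h3; lra.
Qed.

Lemma ge1_l : 1 <= l%:R :> R.
Proof. by rewrite ler1n. Qed.

Lemma cyl_weight n : (6 * 9^-1 ^+ (l * n)) `^ l%:R^-1 <= 6 * 9^-1 ^+ n :> R.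
Proof.
have a0 k : 0 <= 9^-1 ^+ k :> R by apply: exprn_ge0; lra.
have lp : 0 < l%:R :> R by rewrite ltr0n.
rewrite powRM//; apply: ler_pM; rewrite ?powR_ge0//.
  by apply: ler1_powR; [lra | rewrite invf_le1// ge1_l].
by rewrite mulnC exprM -powR_mulrn// -powRrM divff ?gt_eqF// powRr1//.
Qed.

Lemma hausdorff_null_spectrum : hausdorff_measure l%:R^-1 S = 0%E.
Proof.
apply: (hausdorff_null _ _ _ _ countable_right_l2); first by rewrite invr_gt0 ltr0n.
move=> delta e delta0 e0.
have [n hn1 hn2] : exists2 n, 6 * 9^-1 ^+ (l * n) <= delta & 6 * (4 / 9) ^+ n <= e.
  have c1 : (fun n : nat => geometric 6 (9^-1 : R) n) @ \oo --> (0 : R).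
    by apply: cvg_geometric; rewrite ger0_norm; lra.
  have c2 : (fun n : nat => geometric 6 (4 / 9 : R) n) @ \oo --> (0 : R).
    by apply: cvg_geometric; rewrite ger0_norm; lra.
  near \oo => n; exists n.
    apply: (@le_trans _ _ (6 * 9^-1 ^+ n)).
      apply: ler_wpM2l; first by lra.
      by apply: ler_wiXn2l; [lra|lra|rewrite leq_pmull].
    by apply/ltW; near: n; exact: cvgr_lt c1 _ delta0.
  by apply/ltW; near: n; exact: cvgr_lt c2 _ e0.
exists {ffun 'I_n -> bool * bool}, (cyl n), (6 * 9^-1 ^+ (l * n)); split.
- by rewrite hn1 andbT mulr_ge0// exprn_ge0//; lra.
- exact: diam_cyl.
- move=> E SE; have hE : 4 <= E <= 5 by case: SE => /=; rewrite in_itv.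
  have [r|sm] := spectrum_dichotomy _ SE; [by left|right].
  have [|b [b' bb]] := sm (9^-1 ^+ (l * n)); first by apply: exprn_gt0; lra.
  exists [ffun k : 'I_n => (b k, b' k)] => //; split=> //.
  by exists b, b'; split; [move=> k; rewrite ffunE|exact: ltW].
- rewrite card_ffun card_prod card_bool card_ord natrX.
  apply: le_trans hn2; rewrite exprMn mulrCA; apply: ler_wpM2l => //.
  by apply: le_trans (cyl_weight n) _; rewrite ler_wpM2l.
Unshelve. all: by end_near. Qed.

Definition digits x k := odd (Num.truncn (2 ^+ k.+1 * x)).

Lemma truncn_double x : 0 <= x -> (Num.truncn (2 * x))./2 = Num.truncn x.
Proof.
move=> x0; have /andP[h1 h2] := truncn_itv x0.
have x20 : 0 <= 2 * x by rewrite mulr_ge0.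
have /andP[h3 h4] := truncn_itv x20.
set t := Num.truncn x in h1 h2 *; set t2 := Num.truncn (2 * x) in h3 h4 *.
have : (t2 < t.+1 * 2)%N by rewrite -(ltr_nat R) natrM; lra.
have : (t * 2 < t2.+1)%N by rewrite -(ltr_nat R) natrM; lra.
lia.
Qed.

Lemma digits_close x y n : 0 <= x < 1 -> 0 <= y < 1 ->
  (forall k, (k < n)%N -> digits x k = digits y k) -> `|x - y| <= 2^-1 ^+ n.
Proof.
move=> hx hy hd.
have pos z k : 0 <= z < 1 -> 0 <= 2 ^+ k * z :> R.
  by move=> /andP[z0 _]; rewrite mulr_ge0 ?exprn_ge0.
have e k : (k <= n)%N -> Num.truncn (2 ^+ k * x) = Num.truncn (2 ^+ k * y).
  elim: k => [_|k IH kn].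
    have t0 z : 0 <= z < 1 -> Num.truncn z = 0%N.
      by move=> hz; apply/eqP; rewrite truncn_eq//; case/andP: hz.
    by rewrite !expr0 !mul1r !t0.
  have := IH (ltnW kn).
  rewrite -(truncn_double (2 ^+ k * x)) -?(truncn_double (2 ^+ k * y)) ?pos//.
  rewrite !mulrA -!exprS => h2.
  have := hd k kn; rewrite /digits => ho.
  by rewrite -[LHS]odd_double_half -[RHS]odd_double_half h2 ho.
have := e n (leqnn n); have := truncn_itv (pos x n hx); have := truncn_itv (pos y n hy).
move: (Num.truncn _) (Num.truncn _) => t1 t2 h1 h2 e12; subst t2.
have p2 : 0 < 2 ^+ n :> R by rewrite exprn_gt0.
rewrite exprVn -(ler_pM2l p2) divff ?gt_eqF//.
rewrite -[X in X * `|_|]gtr0_norm// -normrM mulrBr ler_norml.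
move: h1 h2; rewrite -natr1; lra.
Qed.

Lemma root_exists x : exists E, 4 <= E <= 5 /\ secular E (penv l (digits x)) (fun=> 0) = 0.
Proof.
have [E h1 h2] := secular_root (R := R) (penv l (digits x)) (fun=> 0) (penv_well _ _) wellpot0.
by exists E.
Qed.

Definition root_of x : R := sval (cid (root_exists x)).

Lemma root_of_bounds x : 4 <= root_of x <= 5.
Proof. by rewrite /root_of; case: cid => E []. Qed.

Lemma root_of_secular x : secular (root_of x) (penv l (digits x)) (fun=> 0) = 0.
Proof. by rewrite /root_of; case: cid => E []. Qed.

Lemma root_of_spectrum x : S (root_of x).
Proof.
split; first by rewrite /= in_itv /= root_of_bounds.
move=> /resolvent_bounded_below[kappa k0 below].
apply: (not_bounded_below W _ _ _ (root_of_bounds x) (penv_well l (digits x))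
  wellpot0 (root_of_secular x) _ kappa k0 below).
by move=> L; exact: sieve_recurrence.
Qed.

Lemma root_separation x y : 0 <= x < 1 -> 0 <= y < 1 -> x != y ->
  exists k, `|x - y| <= 2^-1 ^+ k /\
    2^-1 * 2^-1 ^+ (6 * l * k.+1) <= `|root_of x - root_of y|.
Proof.
move=> hx hy xy.
have ex : exists k, digits x k != digits y k.
  apply: contrapT => no; move/eqP: xy; apply; apply/eqP.
  rewrite -subr_eq0 -normr_le0.
  apply: (@le_geometric_limit _ 2^-1 _ _ 1); first by lra.
  move=> n; rewrite add0r mul1r; apply: digits_close => // k _.
  by apply/eqP; apply: contrapT => /negP h; apply: no; exists k.
have [k dk kmin] := ex_minnP ex.
have agree i : (i < k)%N -> digits x i = digits y i.
  move=> ik; apply/eqP; apply: contraTT ik => /kmin; rewrite -leqNgt//.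
exists k; split; first exact: digits_close.
set E := root_of x; set E' := root_of y.
have hE := root_of_bounds x; have hE' := root_of_bounds y.
have wx := penv_well (R := R) l (digits x); have wy := penv_well (R := R) l (digits y).
have := secular_slope E E' (penv l (digits y)) (fun=> 0) hE hE' wy wellpot0.
move=> /andP[_]; rewrite (root_of_secular y) subr0.
have -> : secular E (penv l (digits y)) (fun=> 0) =
   cf E (penv l (digits x)) - cf E (penv l (digits y)).
  by have := root_of_secular x; rewrite -/E /secular; lra.
have [m em] : exists m, (l * k.+1)%N = m.+1.
  by exists (l * k.+1).-1; rewrite prednK// muln_gt0 l0.
have pm z : penv l z m = - (z k)%:R :> R.
  by rewrite /penv -em dvdn_mulr// mulKn.
have pa i : (i < m)%N -> penv l (digits x) i = penv l (digits y) i :> R.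
  move=> im; rewrite /penv; case: ifP => // /dvdnP[[|j] e] //.
  by rewrite e mulnK//= agree//; nia.
have sep : 36^-1 ^+ m / 54 <= `|cf E (penv l (digits x)) - cf E (penv l (digits y))|.
  case dx : (digits x k); move: dk; rewrite dx eq_sym.
    rewrite eqb_id => /negbTE dy; rewrite distrC.
    apply: (cf_separation E _ _ m) => //; first by move=> i /pa.
    by rewrite !pm dx dy /=; lra.
  rewrite eqbF_neg negbK => dy; apply: (cf_separation E _ _ m) => //.
  by rewrite !pm dx dy /=; lra.
have : 2^-1 ^+ (6 * l * k.+1) <= 36^-1 ^+ m.+1 :> R.
  rewrite -mulnA em exprM; apply: lerXn2r; rewrite ?nnegrE ?exprn_ge0 ?invr_ge0//.
  by rewrite !exprS expr0; lra.
have : 0 <= 36^-1 ^+ m :> R by apply: exprn_ge0; lra.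
rewrite [36^-1 ^+ m.+1]exprS; lra.
Qed.

Lemma hausdorff_pos_spectrum s : 0 <= s -> s <= (6 * l)%:R^-1 -> hausdorff_measure s S != 0%E.
Proof.
move=> s0 sl; have lp : 0 < (6 * l)%:R :> R by rewrite ltr0n muln_gt0.
apply: (hausdorff_lower _ _ root_of 4) => //; first by move=> x _; exact: root_of_spectrum.
move=> x y hx hy xy; have [k [xyk sep]] := root_separation _ _ hx hy xy.
set D := `|_ - _| in sep *; set a := 2^-1 * _ in sep.
have h0 n : 0 < 2^-1 ^+ n :> R by apply: exprn_gt0; lra.
have a0 : 0 < a by rewrite mulr_gt0//; lra.
have D0 : 0 < D by lra.
split=> // D1; apply: le_trans xyk _.
have le1 : a `^ (6 * l)%:R^-1 <= D `^ s.
  apply: (@le_trans _ _ (a `^ s)).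
    by apply: ger_powR => //; rewrite a0 /=; lra.
  by apply: ge0_ler_powR => //; rewrite nnegrE ltW.
have le2 : 2^-1 * 2^-1 ^+ k.+1 <= a `^ (6 * l)%:R^-1.
  rewrite /a powRM; [|lra|exact: ltW].
  apply: ler_pM; [lra|exact: ltW| |].
    by apply: ger1_powR; [lra|rewrite invf_le1// ler1n muln_gt0].
  rewrite (mulnC (6 * l)%N) exprM -(powR_mulrn (6 * l)%N) ?exprn_ge0//.
  by rewrite -powRrM divff ?gt_eqF// powRr1// exprn_ge0.
move: le2; rewrite exprS; lra.
Qed.

Lemma dim_bounds : ((6 * l)%:R^-1%:E <= hausdorff_dim S <= l%:R^-1%:E)%E.
Proof.
apply/andP; split.
  apply: le_ereal_inf_tmp => _ [s [s0 h0] <-]; rewrite lee_fin leNgt.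
  by apply/negP => /ltW /(hausdorff_pos_spectrum _ s0); rewrite h0 eqxx.
apply: ereal_inf_lbound; exists l%:R^-1 => //; split; first by rewrite invr_ge0.
exact: hausdorff_null_spectrum.
Qed.

End Sieve.

Theorem theorem1p3 (R : realType) :
  exists (V : int -> R) (a b : R),
    bounded_fun V /\ a <= b /\
    (forall l : nat, (0 < l)%N ->
      (0 < hausdorff_dim
             (`[a, b] `&` real_spectrum (schroedinger (sieve l V))))%E) /\
    hausdorff_dim (`[a, b] `&` real_spectrum (schroedinger (sieve l V)))
      @[l --> \oo] --> 0%E.
Proof.
exists pot, 4, 5; split; first exact: bounded_pot.
split; first by lra.
split=> [l l0|].
  have /andP[h _] := dim_bounds (R := R) l l0; apply: lt_le_trans h.
  by rewrite lte_fin invr_gt0 ltr0n muln_gt0.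
apply: (@squeeze_cvge _ _ _ _ (cst 0%E) _ (fun l : nat => (l%:R^-1)%:E)).
- near=> l; have l0 : (0 < l)%N by near: l; exact: nbhs_infty_gt.
  have /andP[h ->] := dim_bounds (R := R) l l0; rewrite andbT.
  by apply: le_trans h; rewrite lee_fin invr_ge0.
- exact: cvg_cst.
- rewrite -(cvg_shiftS (fun l : nat => ((l%:R : R)^-1)%:E)).
  exact: cvge_harmonic.
Unshelve. all: by end_near. Qed.
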